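(* Consider the system $\Sigma$: $\dot x=f(x,u)$, $y=h(x,u)$, with $x\in\mathcal X$, $u\in\mathbb R^m$, $y\in\mathbb R^m$, with initial state $x(0)=x_0$, and fix $T>0$. Consider the associated Hamiltonian input-output system $\Sigma^+$ (defined in the context) with Hamiltonian $H^+(x,p,u)=p^\top f(x,u)+u^\top h(x,u)$ and mixed boundary conditions $x(0)=x_0$, $p(T)=0$. Assume that the partial Hessian matrix $\frac{\partial^2 H^+}{\partial u\,\partial u^\top}(x,p,u)$ has full rank and that $\Sigma^+$ is incrementally passive with a storage function $S(x^1,p^1,x^2,p^2)$ that is zero at $(x_0,p_0,x_0,p_0)$, where $p_0=p(0)$ is the initial value of $p$ of a solution of $\Sigma^+$ with $x(0)=x_0$, $p(T)=0$ (for every such solution). Let $y_S:[0,T]\to\mathbb R^m$ be an arbitrary source signal, and let $\hat u:[0,T]\to\mathbb R^m$ be the output of the inverse system $\Sigma^\times$ of $\Sigma^+$ for input $y^+=y_S$ and boundary conditions $x(0)=x_0$, $p(T)=0$. Then $\hat u$ globally minimizes $$P_{x_0,y_S}(u)=\int_0^T (y(t)-y_S(t))^\top u(t)\,dt,\qquad x(0)=x_0,$$ where $y$ is the output of $\Sigma$ for input $u$ and initial state $x_0$; that is, $P_{x_0,y_S}(\hat u)\le P_{x_0,y_S}(u)$ for all input functions $u:[0,T]\to\mathbb R^m$.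
   Context: $\mathcal X$ is the state space manifold of dimension $n$ with cotangent bundle $T^*\mathcal X$; $(x,p)\in T^*\mathcal X$. The maps $f,h$ and all signals are assumed sufficiently regular for the objects below to be well defined (solutions on $[0,T]$, derivatives). The Hamiltonian input-output system $\Sigma^+$ (input $u\in\mathbb R^m$, state $(x,p)$, output $y^+\in\mathbb R^m$) is $$\dot x=\frac{\partial H^+}{\partial p}(x,p,u),\quad \dot p=-\frac{\partial H^+}{\partial x}(x,p,u),\quad y^+=\frac{\partial H^+}{\partial u}(x,p,u),\qquad H^+(x,p,u)=p^\top f(x,u)+u^\top h(x,u).$$ When the partial Hessian of $H^+$ with respect to $u$ has full rank, the equation $y^+=\frac{\partial H^+}{\partial u}(x,p,u)$ is solved for $u$ as a function of $(x,p,y^+)$, and the inverse system $\Sigma^\times$ (input $y^+$, output $u$) is $$\dot x=\frac{\partial H^\times}{\partial p}(x,p,y^+),\quad \dot p=-\frac{\partial H^\times}{\partial x}(x,p,y^+),\quad u=-\frac{\partial H^\times}{\partial y^+}(x,p,y^+),$$ where $H^\times(x,p,y^+)=H^+(x,p,u)-u^\top y^+$ with $u=u(x,p,y^+)$ this solution. As a convention, the full rank assumption is understood to guarantee that this inverse system exists and that, for the given $y_S$, its solution with $x(0)=x_0$, $p(T)=0$ exists on $[0,T]$ and is unique; its output is $\hat u$. Thus for input $\hat u$ and boundary conditions $x(0)=x_0$, $p(T)=0$ the output of $\Sigma^+$ is $y^+=y_S$ on $[0,T]$. Incremental passivity: a system with input $u$, state $z$, output $y$ ($u,y\in\mathbb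 R^m$) is incrementally passive if, given two copies of it with inputs $u^1,u^2$, states $z^1,z^2$, outputs $y^1,y^2$, there exists a nonnegative function $S(z^1,z^2)$ (a storage function) such that along the dynamics of the product system $$\frac{d}{dt}S(z^1,z^2)\le (y^1-y^2)^\top(u^1-u^2).$$ For $\Sigma^+$ one has $z=(x,p)$ and output $y^+$.
   Formalization: S is required to vanish at (x_0,p^1(0),x_0,p^2(0)) for any two solutions of Σ^+ with x(0)=x_0, p(T)=0, whose initial costates may differ; with S zero only at equal costates (x_0,p_0,x_0,p_0) the claim fails. *)

(* Defs.v *)
From HB Require Import structures.
From mathcomp Require Import all_boot all_order all_algebra.
From mathcomp Require Import all_classical all_reals all_analysis.

Set Implicit Arguments.
Unset Strict Implicit.
Unset Printing Implicit Defensive.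

Import Order.TTheory GRing.Theory Num.Theory.
Import numFieldNormedType.Exports.

Local Open Scope classical_set_scope.
Local Open Scope ring_scope.

Section Calculus.
Context {R : realType}.

Definition dotp k (v w : 'rV[R]_k) : R := \sum_(i < k) v 0 i * w 0 i.

(* For open [D] this is the usual notion of class C^k: in finite dimension,
   [F] is C^(k+1) iff it is differentiable and all its directional derivatives
   are C^k. *)
Fixpoint Ck (V W : normedModType R) (k : nat) (D : set V) (F : V -> W) : Prop :=
  if k is k'.+1 then
    (forall a, D a -> differentiable F a) /\
    (forall v, Ck k' D (fun a => 'D_v F a))
  else forall a, D a -> {for a, continuous F}.

Definition smooth (V W : normedModType R) (D : set V) (F : V -> W) : Prop :=
  forall k, Ck k D F.

Definition grad k (F : 'rV[R]_k -> R) (a : 'rV[R]_k) : 'rV[R]_k :=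
  \row_i 'D_(delta_mx 0 i) F a.

Definition hessian k (F : 'rV[R]_k -> R) (a : 'rV[R]_k) : 'M[R]_k :=
  \matrix_(i, j) 'D_(delta_mx 0 i) (fun b => 'D_(delta_mx 0 j) F b) a.

End Calculus.

(* Smooth manifolds of dimension [n], given by an atlas. Each point [x] carries
   a distinguished chart [chart_at x] around it; tangent and cotangent vectors
   at [x] are represented by their components in that chart, so that the
   cotangent bundle has underlying type [pt * 'rV_n]. *)
Record manifold (R : realType) (n : nat) := Manifold {
  pt :> topologicalType;
  chart_index : Type;
  dom : chart_index -> set pt;
  phi : chart_index -> pt -> 'rV[R]_n;
  psi : chart_index -> 'rV[R]_n -> pt;
  chart_at : pt -> chart_index;
  pt_hausdorff : hausdorff_space pt;
  pt_second_countable : @second_countable pt;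
  open_dom : forall i, open (dom i);
  open_phi_dom : forall i, open (phi i @` dom i);
  phi_continuous : forall i x, dom i x -> {for x, continuous (phi i)};
  psi_continuous : forall i q, (phi i @` dom i) q -> {for q, continuous (psi i)};
  phiK : forall i x, dom i x -> psi i (phi i x) = x;
  transition_smooth : forall i j,
    smooth (phi i @` (dom i `&` dom j)) (phi j \o psi i);
  dom_chart_at : forall x, dom (chart_at x) x
}.

Arguments chart_index {R n} _.
Arguments dom {R n _} _.
Arguments phi {R n _} _ _.
Arguments psi {R n _} _ _.
Arguments chart_at {R n _} _.

Section Bundles.
Context {R : realType} {n : nat} {X : manifold R n}.
Implicit Types (i j : chart_index X) (x : X).

(* Change of the components of a vector (resp. covector) at [x] from chart [i]
   to chart [j]. Recall that ['D_v F a = v *m 'J F a] on row vectors; the rule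
   for covectors is the one preserving the pairing [dotp]. *)
Definition vec_change i j x (v : 'rV[R]_n) : 'rV[R]_n :=
  v *m 'J (phi j \o psi i) (phi i x).

Definition covec_change i j x (p : 'rV[R]_n) : 'rV[R]_n :=
  p *m ('J (phi i \o psi j) (phi j x))^T.

Definition covec_coord i (z : X * 'rV[R]_n) : 'rV[R]_n :=
  covec_change (chart_at z.1) i z.1 z.2.

(* Expression of a function on the cotangent bundle in the canonical
   coordinates [(q, pi)] induced by the chart [i]. *)
Definition cotangent_local (A : Type) i (F : X -> 'rV[R]_n -> A)
    (q pi : 'rV[R]_n) : A :=
  let x := psi i q in F x (covec_change i (chart_at x) x pi).

(* A controlled vector field: [f x u] is the component vector, in the chart
   [chart_at x], of an element of T_x X. *)
Definition field_local m i (f : X -> 'rV[R]_m -> 'rV[R]_n)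
    (q : 'rV[R]_n) (u : 'rV[R]_m) : 'rV[R]_n :=
  let x := psi i q in vec_change (chart_at x) i x (f x u).

Definition Ck_field m k (f : X -> 'rV[R]_m -> 'rV[R]_n) : Prop :=
  forall i, Ck k [set a : 'rV[R]_n * 'rV[R]_m | (phi i @` dom i) a.1]
    (fun a => field_local i f a.1 a.2).

Definition Ck_fun m l k (h : X -> 'rV[R]_m -> 'rV[R]_l) : Prop :=
  forall i, Ck k [set a : 'rV[R]_n * 'rV[R]_m | (phi i @` dom i) a.1]
    (fun a => h (psi i a.1) a.2).

Definition Ck_cotangent m l k (F : X -> 'rV[R]_n -> 'rV[R]_m -> 'rV[R]_l) :
    Prop :=
  forall i, Ck k
    [set a : 'rV[R]_n * 'rV[R]_n * 'rV[R]_m | (phi i @` dom i) a.1.1]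
    (fun a => cotangent_local i F a.1.1 a.1.2 a.2).

End Bundles.

Section Systems.
Context {R : realType} {n : nat} (X : manifold R n) {m : nat}.
Local Notation Z := (X * 'rV[R]_n)%type.
Local Notation signal := (R -> 'rV[R]_m).
Local Notation hamiltonian := (X -> 'rV[R]_n -> 'rV[R]_m -> R).

(* Signals and trajectories on [a, b] are represented by functions on [R] whose
   values outside [a, b] are irrelevant. Inputs are continuous and solutions
   are classical: continuous on [a, b], with the differential equation holding
   on the open interval. *)
Definition sigma (f : X -> 'rV[R]_m -> 'rV[R]_n) (h : X -> 'rV[R]_m -> 'rV[R]_m)
    (a b : R) (u : signal) (x : R -> X) (y : signal) : Prop :=
  [/\ {within `[a, b], continuous u},
      {within `[a, b], continuous x},
      (forall t, t \in `]a, b[ -> forall i, dom i (x t) ->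
        is_derive t 1 (fun s => phi i (x s))
          (vec_change (chart_at (x t)) i (x t) (f (x t) (u t))))
    & forall t, t \in `[a, b] -> y t = h (x t) (u t)].

Definition continuous_cotangent (a b : R) (z : R -> Z) : Prop :=
  {within `[a, b], continuous (fun t => (z t).1)} /\
  forall t, t \in `[a, b] -> forall i, dom i (z t).1 ->
    covec_coord i (z s) @[s --> within `[a, b] (nbhs t)] -->
    covec_coord i (z t).

(* Hamilton's equations with input [w]. They are invariant under change of
   chart, so it is harmless to require them in every chart around the state. *)
Definition hamilton (H : hamiltonian) (a b : R) (w : signal) (z : R -> Z) :
    Prop :=
  [/\ {within `[a, b], continuous w},
      continuous_cotangent a b z
    & forall t, t \in `]a, b[ -> forall i, dom i (z t).1 ->
      let Hi q pi := cotangent_local i H q pi (w t) in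
      let q := phi i (z t).1 in
      let pi := covec_coord i (z t) in
      is_derive t 1 (fun s => phi i (z s).1) (grad (fun pi' => Hi q pi') pi) /\
      is_derive t 1 (fun s => covec_coord i (z s))
        (- grad (fun q' => Hi q' pi) q)].

(* The pairing of [p] and [f x u] is computed in the chart [chart_at x]. *)
Definition Hplus (f : X -> 'rV[R]_m -> 'rV[R]_n)
    (h : X -> 'rV[R]_m -> 'rV[R]_m) : hamiltonian :=
  fun x p u => dotp p (f x u) + dotp u (h x u).

Definition sigma_plus f h (a b : R) (u : signal) (z : R -> Z) (y : signal) :
    Prop :=
  hamilton (Hplus f h) a b u z /\
  forall t, t \in `[a, b] -> y t = grad (Hplus f h (z t).1 (z t).2) (u t).

(* [upsilon] solves y^+ = dH^+/du (x, p, u) for u. *)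
Definition solves_output_eq f h
    (upsilon : X -> 'rV[R]_n -> 'rV[R]_m -> 'rV[R]_m) : Prop :=
  forall x p y, grad (Hplus f h x p) (upsilon x p y) = y.

Definition Htimes f h (upsilon : X -> 'rV[R]_n -> 'rV[R]_m -> 'rV[R]_m) :
    hamiltonian :=
  fun x p y => Hplus f h x p (upsilon x p y) - dotp (upsilon x p y) y.

Definition sigma_times f h upsilon (a b : R) (y : signal) (z : R -> Z)
    (u : signal) : Prop :=
  hamilton (Htimes f h upsilon) a b y z /\
  forall t, t \in `[a, b] ->
    u t = - grad (Htimes f h upsilon (z t).1 (z t).2) (y t).

Definition mixed_bc (x0 : X) (T : R) (z : R -> Z) : Prop :=
  (z 0).1 = x0 /\ (z T).2 = 0.

Definition well_posed f h (x0 : X) (T : R) : Prop :=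
  forall u : signal, {within `[0, T], continuous u} ->
  exists z y, sigma_plus f h 0 T u z y /\ mixed_bc x0 T z.

Definition inverse_output f h upsilon (x0 : X) (T : R) (yS uh : signal) :
    Prop :=
  exists zh, [/\ sigma_times f h upsilon 0 T yS zh uh,
    mixed_bc x0 T zh
  & forall z u, sigma_times f h upsilon 0 T yS z u -> mixed_bc x0 T z ->
      forall t, t \in `[0, T] -> z t = zh t /\ u t = uh t].

(* [power_value f h x0 T yS u c] : the value P_{x0,yS}(u) exists and is [c]. *)
Definition power_value f h (x0 : X) (T : R) (yS u : signal) (c : R) : Prop :=
  exists x y, [/\ sigma f h 0 T u x y, x 0 = x0
    & c = \int[lebesgue_measure]_(t in `[0, T]) dotp (y t - yS t) (u t)].

End Systems.

Section Passivity.
Context {R : realType} {m : nat} {Z : Type}.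

(* A system with input and output in R^m and state space [Z], given by its
   trajectories (input, state, output) on time intervals [a, b]. *)
Definition io_system : Type :=
  R -> R -> (R -> 'rV[R]_m) -> (R -> Z) -> (R -> 'rV[R]_m) -> Prop.

Definition storage_function (B : io_system) (S : Z -> Z -> R) : Prop :=
  (forall z1 z2, 0 <= S z1 z2) /\
  forall a b u1 z1 y1 u2 z2 y2, B a b u1 z1 y1 -> B a b u2 z2 y2 ->
    {within `[a, b], continuous (fun t => S (z1 t) (z2 t))} /\
    forall t, t \in `]a, b[ ->
      derivable (fun s => S (z1 s) (z2 s)) t 1 /\
      'D_1 (fun s => S (z1 s) (z2 s)) t <= dotp (y1 t - y2 t) (u1 t - u2 t).

End Passivity.

(* [S] vanishes at the initial states of any two copies of Sigma^+ subject to
   the boundary conditions. The two copies have their own inputs, hence in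
   general different initial costates. *)
Definition storage_zero_at_bvp (R : realType) (n m : nat) (X : manifold R n)
    (f : X -> 'rV[R]_m -> 'rV[R]_n) (h : X -> 'rV[R]_m -> 'rV[R]_m)
    (x0 : X) (T : R) (S : X * 'rV[R]_n -> X * 'rV[R]_n -> R) : Prop :=
  forall u1 z1 y1 u2 z2 y2,
    sigma_plus f h 0 T u1 z1 y1 -> mixed_bc x0 T z1 ->
    sigma_plus f h 0 T u2 z2 y2 -> mixed_bc x0 T z2 ->
    S (x0, (z1 0).2) (x0, (z2 0).2) = 0.

(* Main.v *)
From HB Require Import structures.
Require Import Defs.
From mathcomp Require Import all_boot all_order all_algebra.
From mathcomp Require Import all_classical all_reals all_analysis.
From mathcomp Require Import ring lra.
Import Order.TTheory GRing.Theory Num.Theory.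
Import numFieldNormedType.Exports.
Local Open Scope classical_set_scope.
Local Open Scope ring_scope.

Set Implicit Arguments.
Unset Strict Implicit.
Unset Printing Implicit Defensive.

(** Let [v = u - uh] and let [g s] be the cost of the input [uh + s v]. The
    output of the Hamiltonian system is the variational gradient, up to
    the source term, of the cost: [g' s] is the integral over [[0, T]] of
    the pairing of [v] with [y_s - yS], where [y_s] is the output of the
    Hamiltonian system for the input [uh + s v] (power_variation). The inverse
    system is the Legendre transform of the Hamiltonian system in the input, so
    [yS] is the output for the input [uh] (sigma_times_sigma_plus). Incremental
    passivity of the two copies with inputs [uh + s v] and [uh], together with
    a storage function that vanishes initially and is nonnegative at the end,
    says that [s * g' s >= 0] (passivity_integral_ge0). Hence [g] is
    nondecreasing on [[0, 1]] and [g 0 <= g 1] (power_minimal).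

    The analytic work lies in the formula for [g']. Fix a base solution
    [(x, p)] with input [u], and let [x_s] solve the control system with input
    [u + s v]. In coordinates put [q = x_s - x] and add the pairing of [p] with
    [q] to the error in the first-order expansion of the cost up to time [t].
    By Hamilton's equations the time derivative of this sum is the
    second-order Taylor remainder of the Hamiltonian in position and input,
    at fixed costate; as [q = O(s)] by Gronwall's inequality, the sum is
    [O(s^2)]. At time [T] the costate vanishes and only the error in the cost
    remains (family_quadratic_bound).

    On a manifold this is done chart by chart. The pair of estimates
    [q = O(s)] and [O(s^2)] for the corrected error does not depend on the
    chart, because changing charts preserves the pairing up to a term quadratic
    in [q] (tracked_in_change). A local step in one chart (tracked_in_step) and
    real induction on [[0, T]] conclude. In the local step the perturbed
    trajectory must be kept in the chart, which a barrier argument based on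
    compactness of closed coordinate balls ensures (chart_dependence). *)

(** * Curves, segments and coordinates in a normed space *)

Section Calculus.
Context {R : realType}.

Lemma is_derive_comp (V W : normedModType R) (g : R -> V) (f : V -> W)
    (t : R) (dg : V) :
  is_derive t 1 g dg -> differentiable f (g t) ->
  is_derive t 1 (fun s => f (g s)) ('D_dg f (g t)).
Proof.
move=> [g1 g2] df.
have dg1 : differentiable g t by apply/derivable1_diffP.
have dfg : differentiable (f \o g) t by exact: differentiable_comp.
split; first by apply/derivable1_diffP.
rewrite (deriveE _ dfg) (diff_comp dg1 df) /= -(deriveE _ dg1) g2.
by rewrite deriveE.
Qed.

Lemma is_derive_segment (V : normedModType R) (a d : V) (t : R) :
  is_derive t 1 (fun s : R => a + s *: d) d.
Proof.
have h : is_diff t (fun s : R => a + s *: d) (cst 0 + *:%R^~ d)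
  by exact: is_diffD.
have dh : differentiable (fun s : R => a + s *: d) t by case: h.
split; first by apply/derivable1_diffP.
rewrite deriveE// (@diff_val _ _ _ _ _ _ _ h) /= fctE.
by rewrite scale1r add0r.
Qed.

Lemma segment_MVT (V : normedModType R) (f : V -> R) (a b : V) :
  (forall s : R, s \in `[0, 1] -> differentiable f (a + s *: (b - a))) ->
  exists2 s : R, s \in `[0, 1] & f b - f a = 'D_(b - a) f (a + s *: (b - a)).
Proof.
move=> df.
have der (s : R) : s \in `[0, 1] -> is_derive s 1 (fun s => f (a + s *: (b - a)))
    ('D_(b - a) f (a + s *: (b - a))).
  by move=> s01; apply: (is_derive_comp (is_derive_segment _ _ _)); exact: df.
have der01 (s : R) : s \in `]0, 1[ -> is_derive s 1
    (fun s => f (a + s *: (b - a))) ('D_(b - a) f (a + s *: (b - a))).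
  by move=> s01; apply: der; exact: subset_itv_oo_cc.
have cf : {within `[0, 1], continuous (fun s : R => f (a + s *: (b - a)))}.
  apply: derivable_within_continuous => s s01.
  by have [] := der _ s01.
have [s s01 hs] := MVT_segment ler01 der01 cf.
exists s => //.
by rewrite scale1r scale0r addr0 (addrC a) subrK subr0 mulr1 in hs.
Qed.

(** Finite dimensionality in the form used below: vectors decompose along
    finitely many directions with coordinates bounded by the norm. Unlike
    a choice of basis it passes at once to binary products, which is how
    positions, costates and inputs are grouped. *)
Definition framed (V : normedModType R) : Prop :=
  exists (I : finType) (e : I -> V) (c : I -> V -> R),
    (forall v, v = \sum_k c k v *: e k) /\ (forall k v, `|c k v| <= `|v|).

Lemma rV_coord_le k (v : 'rV[R]_k) i : `|v 0 i| <= `|v|.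
Proof.
rewrite [leRHS]mx_normrE.
exact: (@le_bigmax _ _ _ 0 (fun ij : 'I_1 * 'I_k => `|v ij.1 ij.2|) (0, i)).
Qed.

Lemma rV_norm_le k (v : 'rV[R]_k) (c : R) :
  0 <= c -> (forall i, `|v 0 i| <= c) -> `|v| <= c.
Proof.
move=> c0 h; rewrite [leLHS]mx_normrE; apply: bigmax_le => // -[i j] _.
by rewrite (ord1 i).
Qed.

Lemma framed_rV k : framed 'rV[R]_k.
Proof.
exists 'I_k, (fun i => delta_mx 0 i), (fun i (v : 'rV[R]_k) => v 0 i); split.
  exact: row_sum_delta.
by move=> i v; exact: rV_coord_le.
Qed.

Lemma framed_prod (V W : normedModType R) :
  framed V -> framed W -> framed (V * W)%type.
Proof.
move=> [I [e [c [ce cn]]]] [J [e' [c' [ce' cn']]]].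
exists (I + J)%type.
exists (fun k => match k with inl i => (e i, 0) | inr j => (0, e' j) end).
exists (fun k v => match k with inl i => c i v.1 | inr j => c' j v.2 end).
split=> [v|[i|j] v]; last 2 first.
- by apply: (le_trans (cn _ _)); rewrite prod_normE /= le_max lexx.
- by apply: (le_trans (cn' _ _)); rewrite prod_normE /= le_max lexx orbT.
rewrite big_sumType /= [LHS]surjective_pairing; apply/pair_equal_spec; split.
  rewrite /= (raddf_sum fst) [in LHS](ce v.1).
  rewrite (raddf_sum fst) /= [X in _ + X]big1 ?addr0// => i _.
  by rewrite scaler0.
rewrite /= (raddf_sum snd) [in LHS](ce' v.2).
rewrite (raddf_sum snd) /= [X in X + _]big1 ?add0r// => i _.
by rewrite scaler0.
Qed.

Lemma derive_sumZ (V : normedModType R) (f : V -> R) (a : V) (I : finType)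
    (c : I -> R) (e : I -> V) : differentiable f a ->
  'D_(\sum_k c k *: e k) f a = \sum_k c k * 'D_(e k) f a.
Proof.
move=> df; rewrite deriveE// linear_sum; apply: eq_bigr => k _.
by rewrite linearZ /= deriveE.
Qed.

End Calculus.

(** * Functions of class C^k: closure properties and Taylor estimates *)

Section CkClosure.
Context {R : realType}.
Implicit Types (V W : normedModType R) (k : nat).

(** The witness is the differential of [F], which is the differential of [G]
    because the two increments agree near the base point. *)
Lemma near_eq_differentiable V W (F G : V -> W) (a : V) :
  (\forall b \near a, F b = G b) -> differentiable F a -> differentiable G a.
Proof.
move=> FG dF; have cdF : continuous ('d F a) by exact: diff_continuous.
have GdF : G \o shift a = cst (G a) + 'd F a +o_ 0 id.
  have /eqaddoP dF' := diff_locally dF.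
  apply/eqaddoP => e e0; have := dF' e e0.
  have FG0 : \forall h \near 0, F (h + a) = G (h + a).
    by move: FG; rewrite (near_shift 0) subr0.
  apply: filterS2 FG0 => h hFG.
  change (`|F (h + a) - (F a + 'd F a h)| <= e * `|h| ->
    `|G (h + a) - (G a + 'd F a h)| <= e * `|h|).
  by rewrite hFG (nbhs_singleton FG).
apply/diff_locallyP; rewrite (diff_unique cdF GdF); split => //.
Qed.

Lemma CkS V W k (D : set V) (F : V -> W) : Ck k.+1 D F -> Ck k D F.
Proof.
elim: k F => [F [dF _] a Da|k IHk F [dF DF]].
  exact/differentiable_continuous/dF.
by split=> // v; exact/IHk/DF.
Qed.

Lemma eq_Ck V W k (D : set V) (F G : V -> W) : open D ->
  (forall a, D a -> F a = G a) -> Ck k D F -> Ck k D G.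
Proof.
move=> oD; elim: k F G => [|k IHk] F G FG.
  move=> cF a Da; have nFG : \forall b \near a, F b = G b.
    by near=> b; apply: FG; near: b; exact: open_nbhs_nbhs.
  have FGa : F b @[b --> a] --> G a by rewrite -(FG _ Da); exact: cF.
  by apply: cvg_trans FGa; apply: near_eq_cvg.
have nFG a : D a -> \forall b \near a, F b = G b.
  by move=> Da; near=> b; apply: FG; near: b; exact: open_nbhs_nbhs.
move=> [dF DF]; split=> [a Da|v].
  by apply: near_eq_differentiable (nFG a Da) _; exact: dF.
apply: IHk (DF v) => a Da; exact/near_eq_derive/nFG.
Unshelve. all: by end_near. Qed.

Lemma Ck_cst V W k (D : set V) (w : W) : Ck k D (fun=> w).
Proof.
elim: k w => [|k IHk] w; first by move=> a _; exact: cst_continuous.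
split=> [a _|v]; first exact: differentiable_cst.
have -> : (fun a => 'D_v (fun=> w) a) = fun=> 0.
  by apply/funext => a; exact: derive_cst.
exact: IHk.
Qed.

Lemma Ck_lin V W k (D : set V) (L : {linear V -> W}) :
  continuous L -> Ck k D L.
Proof.
case: k => [cL a _|k cL]; first exact: cL.
split=> [a _|v]; first exact: linear_differentiable.
have -> : (fun a => 'D_v L a) = fun=> L v.
  apply/funext => a.
  by rewrite deriveE ?diff_lin//; exact: linear_differentiable.
exact: Ck_cst.
Qed.

Lemma Ck_comp_lin V V' W k (D : set V) (F : V -> W) (L : {linear V' -> V}) :
  open D -> continuous L -> Ck k D F -> Ck k (L @^-1` D) (fun a => F (L a)).
Proof.
move=> oD cL; have dL a := linear_differentiable a cL.
have oLD : open (L @^-1` D) by apply: open_comp => // a _; exact: cL.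
elim: k F => [|k IHk] F.
  by move=> cF a Da; apply: continuous_comp; [exact: cL|exact: cF].
move=> [dF DF]; split=> [a Da|v].
  by apply: differentiable_comp => //; exact: dF.
apply: eq_Ck (IHk _ (DF (L v))) => // a Da.
rewrite (@deriveE _ _ _ (fun a => F (L a))); last first.
  by apply: differentiable_comp => //; exact: dF.
rewrite (@diff_comp _ _ _ _ L F) //=; last exact: dF.
by rewrite diff_lin// deriveE//; exact: dF.
Qed.

Lemma Ck_lin_comp V W W' k (D : set V) (F : V -> W) (L : {linear W -> W'}) :
  open D -> continuous L -> Ck k D F -> Ck k D (fun a => L (F a)).
Proof.
move=> oD cL; have dL a := linear_differentiable a cL.
elim: k F => [|k IHk] F.
  by move=> cF a Da; apply: continuous_comp; [exact: cF|exact: cL].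
move=> [dF DF]; split=> [a Da|v].
  by apply: differentiable_comp => //; exact: dF.
apply: eq_Ck (IHk _ (DF v)) => // a Da.
rewrite (@deriveE _ _ _ (fun a => L (F a))); last first.
  by apply: differentiable_comp => //; exact: dF.
rewrite (@diff_comp _ _ _ _ F L) //=; last exact: dF.
by rewrite diff_lin// deriveE//; exact: dF.
Qed.

Lemma CkD V W k (D : set V) (F G : V -> W) : open D ->
  Ck k D F -> Ck k D G -> Ck k D (fun a => F a + G a).
Proof.
move=> oD; elim: k F G => [F G cF cG a Da|k IHk F G [dF DF] [dG DG]].
  by apply: continuousD; [exact: cF|exact: cG].
split=> [a Da|v]; first by apply: differentiableD; [exact: dF|exact: dG].
apply: eq_Ck (IHk _ _ (DF v) (DG v)) => // a Da.
by rewrite deriveD//; apply: diff_derivable; [exact: dF|exact: dG].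
Qed.

Lemma CkM V k (D : set V) (F G : V -> R) : open D ->
  Ck k D F -> Ck k D G -> Ck k D (fun a => F a * G a).
Proof.
move=> oD; elim: k F G => [F G cF cG a Da|k IHk F G CF CG].
  by apply: continuousM; [exact: cF|exact: cG].
have [[dF DF] [dG DG]] := (CF, CG).
split=> [a Da|v]; first by apply: differentiableM; [exact: dF|exact: dG].
have := CkD oD (IHk _ _ (CkS CF) (DG v)) (IHk _ _ (CkS CG) (DF v)).
apply: eq_Ck => // a Da.
by rewrite deriveM//; apply: diff_derivable; [exact: dF|exact: dG].
Qed.

Lemma Ck_sum V W k (D : set V) (I : finType) (F : I -> V -> W) : open D ->
  (forall i, Ck k D (F i)) -> Ck k D (fun a => \sum_i F i a).
Proof.
move=> oD CF; elim: (index_enum I) => [|i s IHs].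
  by apply: eq_Ck (Ck_cst _ _ 0) => // a Da; rewrite big_nil.
by apply: eq_Ck (CkD oD (CF i) IHs) => // a Da; rewrite big_cons.
Qed.

Lemma coord_continuous_lin m n (i : 'I_m) (j : 'I_n) :
  continuous (fun A : 'M[R]_(m, n) => A i j).
Proof. by move=> A; exact/differentiable_continuous/differentiable_coord. Qed.

Lemma Ck_coord V m n k (D : set V) (F : V -> 'M[R]_(m, n)) i j : open D ->
  Ck k D F -> Ck k D (fun a => F a i j).
Proof.
move=> oD.
have lin : linear (fun A : 'M[R]_(m, n) => A i j : R^o).
  by move=> c A B; rewrite !mxE.
pose L : {linear 'M[R]_(m, n) -> R^o} :=
  HB.pack (fun A : 'M[R]_(m, n) => A i j : R^o) (GRing.isLinear.Build _ _ _ _ _ lin).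
exact: (@Ck_lin_comp V _ _ k D F L oD (@coord_continuous_lin m n i j)).
Qed.

Lemma Ck_dotp V m k (D : set V) (F G : V -> 'rV[R]_m) : open D ->
  Ck k D F -> Ck k D G -> Ck k D (fun a => dotp (F a) (G a)).
Proof.
move=> oD CF CG; apply: Ck_sum => // i.
by apply: CkM => //; exact: Ck_coord.
Qed.

End CkClosure.

Section Taylor.
Context {R : realType} {V : normedModType R}.
Hypothesis frV : framed V.

Lemma near_ball_radius (P : set V) (a : V) : (\forall b \near a, P b) ->
  exists2 r : R, 0 < r & forall b, `|b - a| < r -> P b.
Proof.
move=> /nbhs_ballP[r /= r0 h]; exists r => // b ba; apply: h.
by rewrite -ball_normE /= distrC.
Qed.

Lemma convex_segment_ball (a0 a b : V) (r s : R) :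
  `|a - a0| < r -> `|b - a0| < r -> s \in `[0, 1] ->
  `|a + s *: (b - a) - a0| < r.
Proof.
move=> ar br; rewrite in_itv /= => /andP[s0 s1].
have -> : a + s *: (b - a) - a0 = (1 - s) *: (a - a0) + s *: (b - a0).
  rewrite scalerBl scale1r -[RHS]addrA (addrC (- _)) -scalerBr.
  by rewrite opprB addrA subrK addrAC.
apply: (le_lt_trans (ler_normD _ _)); rewrite !normrZ.
rewrite (ger0_norm s0) ger0_norm ?subr_ge0//.
have [->|s_neq0] := eqVneq s 0; first by rewrite subr0 mul0r mul1r addr0.
have s_gt0 : 0 < s by rewrite lt_neqAle eq_sym s_neq0.
rewrite [ltRHS](_ : r = (1 - s) * r + s * r); last by rewrite mulrBl mul1r subrK.
apply: ler_ltD; first by rewrite ler_wpM2l ?subr_ge0// ltW.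
by rewrite ltr_pM2l.
Qed.

(** Mean value theorem on the segment from [a] to [b]: the derivative in the
    direction [b - a] is a combination of the finitely many partial
    derivatives, each bounded near [a0] by continuity. *)
Lemma Ck1_locally_lipschitz (D : set V) (f : V -> R) (a0 : V) : open D ->
  Ck 1 D f -> D a0 -> exists L r : R, [/\ 0 <= L, 0 < r,
    forall a, `|a - a0| < r -> D a
  & forall a b, `|a - a0| < r -> `|b - a0| < r ->
      `|f b - f a| <= L * `|b - a|].
Proof.
move=> oD [df Df] Da0; have [I [e [c [ce cn]]]] := frV.
pose L := \sum_k (`|'D_(e k) f a0| + 1).
have near1 : \forall a \near a0, D a /\
    forall k, `|'D_(e k) f a| <= `|'D_(e k) f a0| + 1.
  apply: filterI; first exact: open_nbhs_nbhs.
  apply: filter_forall => k.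
  have := @cvgr_norm_le R _ _ _ _ _ _ (Df (e k) a0 Da0).
  by apply; rewrite ltrDl.
have [r r0 hr] := near_ball_radius near1.
exists L, r; split => //.
- by apply: sumr_ge0 => k _; rewrite addr_ge0.
- by move=> a /hr[].
move=> a b ar br.
have [s s01|s s01 ->] := @segment_MVT R V f a b.
  by apply: df; have [] := hr _ (convex_segment_ball ar br s01).
have [Dc hc] := hr _ (convex_segment_ball ar br s01).
set a' := (X in 'D_(b - a) f X) in Dc hc *.
rewrite [in leLHS](ce (b - a)) derive_sumZ; last exact: df.
apply: (le_trans (ler_norm_sum _ _ _)).
rewrite mulr_suml ler_sum// => k _; rewrite normrM mulrC.
by apply: ler_pM => //; exact: hc.
Qed.

(** By the mean value theorem the remainder is the variation of the
    derivative in the direction [b - a] along the segment, and the partial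
    derivatives, being of class C^1, are locally Lipschitz. *)
Lemma Ck2_quadratic_remainder (D : set V) (f : V -> R) (a0 : V) : open D ->
  Ck 2 D f -> D a0 -> exists M r : R, [/\ 0 <= M, 0 < r,
    forall a, `|a - a0| < r -> D a
  & forall a b, `|a - a0| < r -> `|b - a0| < r ->
      `|f b - f a - 'D_(b - a) f a| <= M * `|b - a| ^+ 2].
Proof.
move=> oD [df Df] Da0; have [I [e [c [ce cn]]]] := frV.
have /choice[L /choice[r hLr]] : forall k, exists L r : R, [/\ 0 <= L, 0 < r,
    forall a, `|a - a0| < r -> D a
  & forall a b, `|a - a0| < r -> `|b - a0| < r ->
      `|'D_(e k) f b - 'D_(e k) f a| <= L * `|b - a|].
  by move=> k; exact: (@Ck1_locally_lipschitz D).
pose r0 := \big[Num.min/1]_k r k.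
have r0_gt0 : 0 < r0 by apply: lt_bigmin => // k _; have [] := hLr k.
have r0_le k : r0 <= r k by exact: bigmin_le.
have [r1 r1_gt0 hr1] := near_ball_radius (open_nbhs_nbhs (conj oD Da0)).
exists (\sum_k L k), (Num.min r0 r1); split.
- by apply: sumr_ge0 => k _; have [] := hLr k.
- by rewrite lt_min r0_gt0.
- by move=> a; rewrite lt_min => /andP[_ /hr1].
move=> a b; rewrite !lt_min => /andP[ar0 ar1] /andP[br0 br1].
have [s s01|s s01 ->] := @segment_MVT R V f a b.
  by apply: df; exact/hr1/convex_segment_ball.
set a' := a + s *: (b - a).
have a'r0 : `|a' - a0| < r0 by exact: convex_segment_ball.
have a'a : `|a' - a| <= `|b - a|.
  rewrite /a' (addrC a) addrK normrZ; move: s01; rewrite in_itv /= => /andP[? ?].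
  by rewrite ger0_norm// ler_piMl.
rewrite [in leLHS](ce (b - a)) !derive_sumZ; [|by apply/df/hr1|]; last first.
  by apply: df; apply/hr1/convex_segment_ball.
rewrite -sumrB; apply: (le_trans (ler_norm_sum _ _ _)).
rewrite mulr_suml ler_sum// => k _; rewrite -mulrBr normrM expr2 mulrCA.
have [Lk0 _ _ hL] := hLr k.
apply: ler_pM => //; apply: (le_trans (hL a a' _ _)).
- exact: lt_le_trans ar0 _.
- exact: lt_le_trans a'r0 _.
- by rewrite ler_wpM2l.
Qed.

End Taylor.

(** * Real induction, barriers, Gronwall and primitives *)

Section RealLine.
Context {R : realType}.

(** The supremum of the points of [[a, b]] where [P] holds can be reached
    from below and crossed by one local step, hence it is [b]. *)
Lemma real_induction (a b : R) (P : R -> Prop) : a <= b -> P a ->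
  (forall t, t \in `[a, b] -> exists2 d : R, 0 < d & forall s s',
     a <= s -> s <= s' -> s' <= b -> `|s - t| < d -> `|s' - t| < d ->
     P s -> P s') -> P b.
Proof.
move=> ab Pa step; pose E := [set s | a <= s <= b /\ P s].
have Ea : E a by rewrite /E /= lexx ab.
have hE : has_sup E.
  by split; [exists a|exists b => s [/andP[]]].
have sa : a <= sup E by apply: sup_ubound => //; exact: hE.2.
have sb : sup E <= b by apply: sup_le_ub; [exists a|move=> s [/andP[]]].
have tab : sup E \in `[a, b] by rewrite in_itv /= sa.
have [d d0 hd] := step _ tab.
have [s Es ds] := sup_adherent d0 hE.
have ssup : s <= sup E by apply: sup_ubound => //; exact: hE.2.
have [/andP[as_ sb'] Ps] := Es.
have sd : `|s - sup E| < d by rewrite distrC ger0_norm ?subr_ge0// ltrBlDr -ltrBlDl.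
pose s' := Num.min b (sup E + d / 2).
have d2 : 0 < d / 2 by rewrite divr_gt0.
have s'b : s' <= b by rewrite ge_min lexx.
have sups' : sup E <= s' by rewrite le_min sb /= lerDl ltW.
have ss' : s <= s' := le_trans ssup sups'.
have s'd : `|s' - sup E| < d.
  rewrite ger0_norm ?subr_ge0// ltrBlDl gt_min; apply/orP; right.
  by rewrite ltrD2l [ltRHS]splitr ltrDl.
have Ps' : P s' by apply: (hd s).
have Es' : E s' by split => //; rewrite s'b (le_trans as_ ss').
have s'sup : s' <= sup E by apply: sup_ubound => //; exact: hE.2.
suff <- : s' = b by [].
apply/le_anti; rewrite s'b /= leNgt; apply/negP => s'lt.
have s'E : s' = sup E + d / 2 by move: s'lt; rewrite /s' gt_min ltxx /= => /ltW/min_r.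
by move: s'sup; rewrite s'E gerDl leNgt d2.
Qed.

Lemma within_itvP (T : topologicalType) (a b : R) (f : R -> T) :
  {within `[a, b], continuous f} <->
  (forall t, t \in `[a, b] ->
    f s @[s --> within `[a, b] (nbhs t)] --> f t).
Proof. exact: subspace_continuousP. Qed.

Lemma near_within_itv (a b t : R) (P : set R) :
  (\forall s \near within `[a, b] (nbhs t), P s) ->
  exists2 d : R, 0 < d &
    forall s, s \in `[a, b] -> `|s - t| < d -> P s.
Proof.
rewrite near_withinE => /nbhs_ballP[d /= d0 h]; exists d => // s sab st.
by apply: h => //; rewrite -ball_normE /= distrC.
Qed.

(** A path confined to [K] as long as it has stayed in the larger open set
    [O] never leaves [O]: where it sits in [K] it remains in [O] for a
    while, and where it is off the closed set [K] so are nearby earlier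
    points, contradicting the confinement. This is what keeps a perturbed
    trajectory inside the domain of a chart. *)
Lemma barrier (T : topologicalType) (a b : R) (x : R -> T) (O K : set T) :
  {within `[a, b], continuous x} -> open O -> closed K -> K `<=` O -> K (x a) ->
  (forall t, t \in `[a, b] ->
     (forall s, s \in `[a, t] -> O (x s)) -> K (x t)) ->
  forall t, t \in `[a, b] -> K (x t).
Proof.
move=> /within_itvP cx oO cK KO Kxa h t tab.
have ab : a <= b by move: tab; rewrite in_itv => /andP[]; exact: le_trans.
suff Ob : forall s, s \in `[a, b] -> O (x s).
  apply: h => // s; rewrite !in_itv /= => /andP[as_ st]; apply: Ob.
  by rewrite in_itv /= as_ (le_trans st)//; move: tab; rewrite in_itv => /andP[].
apply: (@real_induction a b (fun t => forall s, s \in `[a, t] -> O (x s))) => //.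
  by move=> s; rewrite in_itv /= => /le_anti <-; exact: KO.
move=> u uab; have [Kxu|nKxu] := pselect (K (x u)).
  have [d d0 hd] : exists2 d : R, 0 < d &
      forall s, s \in `[a, b] -> `|s - u| < d -> O (x s).
    apply: near_within_itv; apply: (cx u uab).
    by apply: open_nbhs_nbhs; split => //; exact: KO.
  exists d => // s s' as_ ss' s'b su s'u Os r; rewrite in_itv /= => /andP[ar rs'].
  have [rs|sr] := leP r s; first by apply: Os; rewrite in_itv /= ar.
  apply: hd; first by rewrite in_itv /= ar (le_trans rs').
  by move: su s'u; rewrite !ltr_norml => /andP[h1 _] /andP[_ h2]; lra.
have [d d0 hd] : exists2 d : R, 0 < d &
    forall s, s \in `[a, b] -> `|s - u| < d -> ~ K (x s).
  apply: near_within_itv; apply: (cx u uab (~` K)).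
  by apply: open_nbhs_nbhs; split => //; exact: closed_openC.
exists d => // s s' as_ ss' s'b su s'u Os; exfalso.
have sab : s \in `[a, b] by rewrite in_itv /= as_ (le_trans ss').
by apply: (hd s) => //; apply: h.
Qed.

(** The function [(e t + c) * expR (K * (a - t))] has nonpositive
    derivative. *)
Lemma gronwall (a b K c : R) (e de : R -> R) : a <= b ->
  {within `[a, b], continuous e} ->
  (forall t, t \in `]a, b[ -> is_derive t 1 e (de t)) ->
  (forall t, t \in `]a, b[ -> de t <= K * (e t + c)) ->
  e b + c <= (e a + c) * expR (K * (b - a)).
Proof.
move=> ab /within_itvP ce hde hle.
pose g t := (e t + c) * expR (K * (a - t)).
have dg t : t \in `]a, b[ -> is_derive t 1 g
    ((e t + c) *: (expR (K * (a - t)) * - K) + expR (K * (a - t)) *: (de t + 0)).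
  move=> tab.
  have h1 : is_derive t 1 (fun t : R => K * (a - t)) (- K).
    have := is_deriveZ K (is_deriveB (is_derive_cst a t 1) (is_derive_id t 1)).
    by rewrite sub0r /GRing.scale /= mulrN1.
  have h2 := @is_derive1_comp R expR (fun t => K * (a - t)) _ _ _
    (is_derive_expR _) h1.
  have h3 := is_deriveD (hde _ tab) (is_derive_cst c t 1).
  exact: is_deriveM h3 h2.
have gba : g b <= g a.
  apply: (@ler0_derive1_nincr R g a b) => //.
  - by move=> t /dg[].
  - move=> t tab; rewrite derive1E; have [_ ->] := dg t tab.
    rewrite addr0 /GRing.scale /= mulrN mulrN mulrCA -mulrN -mulrDr.
    by rewrite pmulr_rle0 ?expR_gt0// addrC mulrC subr_le0 hle.
  - apply/within_itvP => t tab; apply: cvgM.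
      by apply: cvgD; [exact: ce|exact: cvg_cst].
    apply: cvg_within_filter.
    apply: (@cvg_comp _ _ _ (fun t : R => K * (a - t)) expR); last exact: continuous_expR.
    by apply: cvgM; [exact: cvg_cst|apply: cvgB; [exact: cvg_cst|exact: cvg_id]].
rewrite /g subrr mulr0 expR0 mulr1 in gba.
have := ler_wpM2r (expR_ge0 (K * (b - a))) gba.
by rewrite -mulrA -expRD -mulrDr addrA subrK subrr mulr0 expR0 mulr1.
Qed.

Lemma norm_le_of_derive (a b c : R) (g dg : R -> R) : a <= b ->
  {within `[a, b], continuous g} ->
  (forall t, t \in `]a, b[ -> is_derive t 1 g (dg t)) ->
  (forall t, t \in `[a, b] -> `|dg t| <= c) ->
  `|g b - g a| <= c * (b - a).
Proof.
move=> ab cg hdg hle; have [t tab ->] := MVT_segment ab hdg cg.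
by rewrite normrM [X in _ * X]ger0_norm ?subr_ge0// ler_wpM2r ?subr_ge0// hle.
Qed.

Lemma primitive_of_continuous (T : R) (w : R -> R) : 0 < T ->
  {within `[0, T], continuous w} ->
  let W t := \int[lebesgue_measure]_(s in `[0, t]) w s in
  [/\ W 0 = 0, {within `[0, T], continuous W}
    & forall t, t \in `]0, T[ -> is_derive t 1 W (w t)].
Proof.
move=> T0 cw W.
have iw : lebesgue_measure.-integrable `[0, T] (EFin \o w).
  by apply: continuous_compact_integrable => //; exact: segment_compact.
split.
- by rewrite /W set_itv1 Rintegral_set1.
- exact: parameterized_integral_continuous (ltW T0) iw.
move=> t t0T.
have [dW WE] : derivable W t 1 /\ W^`()%classic t = w t.
  move: (t0T); rewrite in_itv /= => /andP[t0 tT].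
  apply: (continuous_FTC1 tT iw) => //.
  by have [+ _ _] := (continuous_within_itvP w T0).1 cw; exact.
by split; [exact: dW|rewrite -derive1E; exact: WE].
Qed.

End RealLine.

(** * The pairing of row vectors, partial derivatives, Jacobians *)

Section Dotp.
Context {R : realType}.

Lemma dotpC k (v w : 'rV[R]_k) : dotp v w = dotp w v.
Proof. by apply: eq_bigr => i _; rewrite mulrC. Qed.

Lemma dotpDl k (v v' w : 'rV[R]_k) : dotp (v + v') w = dotp v w + dotp v' w.
Proof.
by rewrite -big_split; apply: eq_bigr => i _; rewrite mxE mulrDl.
Qed.

Lemma dotpZl k c (v w : 'rV[R]_k) : dotp (c *: v) w = c * dotp v w.
Proof. by rewrite mulr_sumr; apply: eq_bigr => i _; rewrite mxE mulrA. Qed.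

Lemma dotpNl k (v w : 'rV[R]_k) : dotp (- v) w = - dotp v w.
Proof. by rewrite -scaleN1r dotpZl mulN1r. Qed.

Lemma dotpBl k (v v' w : 'rV[R]_k) : dotp (v - v') w = dotp v w - dotp v' w.
Proof. by rewrite dotpDl dotpNl. Qed.

Lemma dotpDr k (v w w' : 'rV[R]_k) : dotp v (w + w') = dotp v w + dotp v w'.
Proof. by rewrite !(dotpC v) dotpDl. Qed.

Lemma dotpZr k c (v w : 'rV[R]_k) : dotp v (c *: w) = c * dotp v w.
Proof. by rewrite !(dotpC v) dotpZl. Qed.

Lemma dotpBr k (v w w' : 'rV[R]_k) : dotp v (w - w') = dotp v w - dotp v w'.
Proof. by rewrite !(dotpC v) dotpBl. Qed.

Lemma dotp0l k (v : 'rV[R]_k) : dotp 0 v = 0.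
Proof. by rewrite -(scale0r 0) dotpZl mul0r. Qed.

Lemma dotp0r k (v : 'rV[R]_k) : dotp v 0 = 0.
Proof. by rewrite dotpC dotp0l. Qed.

Lemma dotp_mulmx k l (v : 'rV[R]_k) (A : 'M[R]_(l, k)) (w : 'rV[R]_l) :
  dotp (v *m A^T) w = dotp v (w *m A).
Proof.
have dotpE j (a b : 'rV[R]_j) : dotp a b = (a *m b^T) 0 0.
  by rewrite mxE; apply: eq_bigr => i _; rewrite mxE.
by rewrite !dotpE trmx_mul mulmxA.
Qed.

Lemma dotp_norm_le k (v w : 'rV[R]_k) : `|dotp v w| <= k%:R * (`|v| * `|w|).
Proof.
apply: (le_trans (ler_norm_sum _ _ _)).
rewrite mulr_natl -[X in _ *+ X]card_ord -sumr_const; apply: ler_sum => i _.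
by rewrite normrM ler_pM// rV_coord_le.
Qed.

(** The norm of row vectors is the sup norm; [dotp v v] is equivalent to its
    square and, unlike it, can be differentiated. *)
Lemma sqr_norm_le_dotp k (v : 'rV[R]_k) : `|v| ^+ 2 <= dotp v v.
Proof.
have vv0 : 0 <= dotp v v.
  by apply: sumr_ge0 => i _; rewrite -expr2 sqr_ge0.
rewrite -(sqr_sqrtr vv0) ler_pXn2r ?nnegrE ?sqrtr_ge0//.
apply: rV_norm_le => [|i]; first exact: sqrtr_ge0.
rewrite -sqrtr_sqr ler_wsqrtr// /dotp (bigD1 i)//= expr2 lerDl.
by apply: sumr_ge0 => j _; rewrite -expr2 sqr_ge0.
Qed.

Lemma is_derive_coord (V : normedModType R) m n (F : V -> 'M[R]_(m, n))
    (a v : V) dF i j :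
  is_derive a v F dF -> is_derive a v (fun b => F b i j) (dF i j).
Proof.
move=> [h1 h2]; split; first by move/derivable_mxP: h1 => h1; exact: h1.
by rewrite -h2 derive_mx// mxE.
Qed.

Lemma is_derive_dotp (V : normedModType R) k (F G : V -> 'rV[R]_k)
    (a v : V) dF dG :
  is_derive a v F dF -> is_derive a v G dG ->
  is_derive a v (fun b => dotp (F b) (G b)) (dotp dF (G a) + dotp (F a) dG).
Proof.
move=> hF hG.
have h i : is_derive a v (fun b => F b 0 i * G b 0 i)
    (F a 0 i *: dG 0 i + G a 0 i *: dF 0 i).
  by apply: is_deriveM; exact: is_derive_coord.
have := is_derive_sum h.
rewrite fct_sumE => H; apply: (is_derive_eq H).
rewrite big_split /= addrC; congr (_ + _); apply: eq_bigr => i _.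
by rewrite [LHS]mulrC.
Qed.

Lemma cvg_dotp (T : Type) (FF : set_system T) k (F G : T -> 'rV[R]_k) v w :
  Filter FF -> F s @[s --> FF] --> v -> G s @[s --> FF] --> w ->
  dotp (F s) (G s) @[s --> FF] --> dotp v w.
Proof.
move=> fFF hF hG.
have h i : F s 0 i * G s 0 i @[s --> FF] --> v 0 i * w 0 i.
  apply: cvgM.
    exact: (@cvg_comp _ _ _ F (fun M : 'rV[R]_k => M 0 i) FF (nbhs v) _ hF
      (@coord_continuous_lin _ _ _ 0 i v)).
  exact: (@cvg_comp _ _ _ G (fun M : 'rV[R]_k => M 0 i) FF (nbhs w) _ hG
    (@coord_continuous_lin _ _ _ 0 i w)).
by apply: cvg_big => [|i _]; [exact: add_continuous|exact: h].
Qed.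

Lemma dotp_grad k (F : 'rV[R]_k -> R) a v : differentiable F a ->
  dotp v (grad F a) = 'D_v F a.
Proof.
move=> dF; rewrite [in RHS](row_sum_delta v) derive_sumZ//.
by apply: eq_bigr => i _; rewrite mxE.
Qed.

Lemma grad_affine k (w : 'rV[R]_k) (c : R) a :
  grad (fun b => dotp b w + c) a = w.
Proof.
apply/rowP => i; rewrite mxE.
have h := is_deriveD (is_derive_dotp (is_derive_id a (delta_mx 0 i))
  (is_derive_cst w a (delta_mx 0 i))) (is_derive_cst c a (delta_mx 0 i)).
rewrite (@derive_val _ _ _ _ _ _ _ h) dotp0r !addr0 /dotp (bigD1 i)//= mxE !eqxx mul1r.
rewrite big1 ?addr0// => j ji; rewrite mxE.
by rewrite (negbTE ji) mul0r.
Qed.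

End Dotp.

Section Partial.
Context {R : realType}.
Implicit Types U V W : normedModType R.

Lemma derive_partial1 U V W (F : U * V -> W) (a : U * V) (d : U) :
  'D_d (fun b => F (b, a.2)) a.1 = 'D_(d, 0) F a.
Proof.
case: a => a1 a2; rewrite /derive /=.
set f1 := fun h => _; set f2 := fun h => _.
suff -> : f1 = f2 by []. apply/funext => s; rewrite /f1 /f2 /=.
by congr (_ *: (F _ - _));
  rewrite /GRing.add /GRing.scale /= /add_pair /scale_pair /= scaler0 add0r.
Qed.

Lemma derive_partial2 U V W (F : U * V -> W) (a : U * V) (d : V) :
  'D_d (fun b => F (a.1, b)) a.2 = 'D_(0, d) F a.
Proof.
case: a => a1 a2; rewrite /derive /=.
set f1 := fun h => _; set f2 := fun h => _.
suff -> : f1 = f2 by []. apply/funext => s; rewrite /f1 /f2 /=.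
by congr (_ *: (F _ - _));
  rewrite /GRing.add /GRing.scale /= /add_pair /scale_pair /= scaler0 add0r.
Qed.

Lemma differentiable_partial1 U V W (F : U * V -> W) (a : U * V) :
  differentiable F a -> differentiable (fun b => F (b, a.2)) a.1.
Proof.
move=> dF; apply: (@differentiable_comp _ _ _ _ (fun b => (b, a.2)) F).
  by apply: differentiable_pair => //; exact: differentiable_cst.
by rewrite -surjective_pairing.
Qed.

Lemma differentiable_partial2 U V W (F : U * V -> W) (a : U * V) :
  differentiable F a -> differentiable (fun b => F (a.1, b)) a.2.
Proof.
move=> dF; apply: (@differentiable_comp _ _ _ _ (fun b => (a.1, b)) F).
  by apply: differentiable_pair => //; exact: differentiable_cst.
by rewrite -surjective_pairing.
Qed.

Lemma fst_continuous_lin U V : continuous (fst : U * V -> U).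
Proof. by move=> a; exact: cvg_fst. Qed.

Lemma snd_continuous_lin U V : continuous (snd : U * V -> V).
Proof. by move=> a; exact: cvg_snd. Qed.

(** The envelope property of the Legendre transform: at a critical point in
    the input, the terms coming from the derivative of [U] cancel. *)
Lemma derive_legendre V k (G : V * 'rV[R]_k -> R)
    (U : V * 'rV[R]_k -> 'rV[R]_k) (a d : V * 'rV[R]_k) :
  differentiable U a -> differentiable G (a.1, U a) ->
  grad (fun u => G (a.1, u)) (U a) = a.2 ->
  'D_d (fun b => G (b.1, U b) - dotp (U b) b.2) a
    = 'D_(d.1, 0) G (a.1, U a) - dotp (U a) d.2.
Proof.
move=> dU dG gG.
have dfst : is_diff a (fst : V * 'rV[R]_k -> V) fst.
  apply: DiffDef; first exact/linear_differentiable/fst_continuous_lin.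
  by rewrite diff_lin//; exact: fst_continuous_lin.
have dsnd : is_diff a (snd : V * 'rV[R]_k -> 'rV[R]_k) snd.
  apply: DiffDef; first exact/linear_differentiable/snd_continuous_lin.
  by rewrite diff_lin//; exact: snd_continuous_lin.
have dpair : differentiable (fun b : V * 'rV[R]_k => (b.1, U b)) a.
  by apply: differentiable_pair => //; exact: ex_diff.
have dGU : differentiable (fun b => G (b.1, U b)) a.
  exact: (@differentiable_comp _ _ _ _ (fun b => (b.1, U b)) G).
have DGU : 'D_d (fun b => G (b.1, U b)) a =
    'D_(d.1, 0) G (a.1, U a) + dotp ('D_d U a) a.2.
  rewrite deriveE// (@diff_comp _ _ _ _ (fun b => (b.1, U b)) G)//=.
  rewrite diff_pair//=.
  rewrite diff_val -deriveE// -[in RHS]gG dotp_grad; last first.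
    exact: (@differentiable_partial2 _ _ _ G (a.1, U a)).
  rewrite (@derive_partial2 _ _ _ G (a.1, U a)) -!deriveE//.
  rewrite !(@deriveE _ _ _ G)// -raddfD /=; congr ('d G _ _).
  by rewrite /GRing.add /= /add_pair /= addr0 add0r.
have hd : is_derive a d (fun b => dotp (U b) b.2) (dotp ('D_d U a) a.2 + dotp (U a) d.2).
  apply: is_derive_dotp; first by apply/derivableP/diff_derivable.
  split; first by apply/diff_derivable; exact: ex_diff.
  by rewrite deriveE ?diff_val//; exact: ex_diff.
rewrite deriveB; last 2 first.
- exact: diff_derivable.
- by case: hd.
by rewrite DGU (@derive_val _ _ _ _ _ _ _ hd) opprD addrA addrK.
Qed.

Lemma jacobian_comp n1 n2 n3 (F : 'rV[R]_n1 -> 'rV[R]_n2)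
    (G : 'rV[R]_n2 -> 'rV[R]_n3) a b : F a = b ->
  differentiable F a -> differentiable G b ->
  'J (G \o F) a = 'J F a *m 'J G b.
Proof.
move=> <- dF dG; apply/row_matrixP => i.
have dGF := differentiable_comp dF dG.
rewrite rowE row_mul rowE -(deriveEjacobian _ dGF) -(deriveEjacobian _ dF).
rewrite -(deriveEjacobian _ dG) (deriveE _ dGF) (deriveE _ dF) (deriveE _ dG).
by rewrite (diff_comp dF dG).
Qed.

Lemma near_eq_jacobian n1 n2 (F G : 'rV[R]_n1 -> 'rV[R]_n2) a :
  differentiable F a -> (\forall b \near a, F b = G b) -> 'J F a = 'J G a.
Proof.
move=> dF FG; have dG : differentiable G a.
  by apply: (@near_eq_differentiable R _ _ F).
have E v : 'd F a v = 'd G a v.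
  have H : 'D_v F a = 'D_v G a by apply: (@near_eq_derive _ _ _ F G a v).
  exact: (etrans (esym (deriveE v dF)) (etrans H (deriveE v dG))).
have {}E : 'd F a = 'd G a :> ('rV[R]_n1 -> 'rV[R]_n2).
  by apply/funext => v; exact: E.
exact: (congr1 (fun D : 'rV[R]_n1 -> 'rV[R]_n2 => lin1_mx D) E).
Qed.

Lemma jacobian_id k (a : 'rV[R]_k) : 'J id a = 1%:M.
Proof.
apply/row_matrixP => i; have did : differentiable (@id 'rV[R]_k) a by exact: ex_diff.
by rewrite !rowE -(deriveEjacobian _ did) derive_id mulmx1.
Qed.

End Partial.

(** * Charts, covectors and the Hamiltonian in coordinates *)

Section Charts.
Context {R : realType} {n : nat} (X : manifold R n).
Implicit Types (i j k : chart_index X) (x : X) (p v : 'rV[R]_n).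

Lemma psi_phi_dom i q : (phi i @` dom i) q ->
  dom i (psi i q) /\ phi i (psi i q) = q.
Proof. by move=> [x dx <-]; rewrite phiK. Qed.

Lemma phi_dom i x : dom i x -> (phi i @` dom i) (phi i x).
Proof. by move=> dx; exists x. Qed.

Lemma near_dom i x : dom i x -> \forall y \near x, dom i y.
Proof. by move=> dx; apply: open_nbhs_nbhs; split=> //; exact: open_dom. Qed.

(** The image of the overlap is the open image of [dom i] cut by the preimage
    of [dom j] under the inverse chart. *)
Lemma overlap_open i j : open (phi i @` (dom i `&` dom j)).
Proof.
rewrite openE => q [x [di dj] xq]; rewrite /interior.
have Dq : (phi i @` dom i) q by rewrite -xq; exact: phi_dom.
have n1 : \forall r \near q, (phi i @` dom i) r.
  by apply: open_nbhs_nbhs; split=> //; exact: open_phi_dom.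
have n2 : \forall r \near q, dom j (psi i r).
  by apply: (psi_continuous Dq); rewrite -xq phiK//; exact: near_dom.
near=> r; have Dr : (phi i @` dom i) r by near: r.
exists (psi i r); last exact: (psi_phi_dom Dr).2.
by split; [exact: (psi_phi_dom Dr).1|near: r].
Unshelve. all: by end_near. Qed.

Lemma transition_Ck i j (l : nat) : Ck l (phi i @` (dom i `&` dom j)) (phi j \o psi i).
Proof. exact: transition_smooth. Qed.

Lemma transition_differentiable i j x : dom i x -> dom j x ->
  differentiable (phi j \o psi i) (phi i x).
Proof.
move=> di dj; have [+ _] := transition_Ck i j 1.
by apply; exists x.
Qed.

Lemma transitionE i j x : dom i x -> (phi j \o psi i) (phi i x) = phi j x.
Proof. by move=> di; rewrite /= phiK. Qed.

(** Chain rule: near [phi i x] the direct transition is the composite of the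
    two transitions through the chart [j]. *)
Lemma jacobian_cocycle i j k x : dom i x -> dom j x -> dom k x ->
  'J (phi k \o psi i) (phi i x)
    = 'J (phi j \o psi i) (phi i x) *m 'J (phi k \o psi j) (phi j x).
Proof.
move=> di dj dk.
rewrite -(jacobian_comp (transitionE j di) (transition_differentiable di dj)
  (transition_differentiable dj dk)).
apply: near_eq_jacobian; first exact: transition_differentiable.
have : \forall q \near phi i x, (phi i @` (dom i `&` dom j)) q.
  by apply: open_nbhs_nbhs; split; [exact: overlap_open|exists x].
by apply: filterS => _ [y [diy djy] <-] /=; rewrite !phiK.
Qed.

Lemma jacobian_chart_id i x : dom i x -> 'J (phi i \o psi i) (phi i x) = 1%:M.
Proof.
move=> di; rewrite -(jacobian_id (phi i x)).
apply: near_eq_jacobian; first exact: transition_differentiable.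
have : \forall q \near phi i x, (phi i @` dom i) q.
  by apply: open_nbhs_nbhs; split; [exact: open_phi_dom|exact: phi_dom].
by apply: filterS => q /psi_phi_dom[].
Qed.

Lemma covec_change_cocycle i j k x p : dom i x -> dom j x -> dom k x ->
  covec_change j k x (covec_change i j x p) = covec_change i k x p.
Proof.
move=> di dj dk; rewrite /covec_change -mulmxA -trmx_mul.
by rewrite -jacobian_cocycle.
Qed.

Lemma covec_change_id i x p : dom i x -> covec_change i i x p = p.
Proof. by move=> di; rewrite /covec_change jacobian_chart_id// trmx1 mulmx1. Qed.

Lemma dotp_covec_change i j x p v :
  dotp (covec_change i j x p) v = dotp p (vec_change j i x v).
Proof. exact: dotp_mulmx. Qed.

Lemma covec_coord_change i j (z : X * 'rV[R]_n) : dom i z.1 -> dom j z.1 ->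
  covec_change j i z.1 (covec_coord j z) = covec_coord i z.
Proof.
by move=> di dj; apply: covec_change_cocycle => //; exact: dom_chart_at.
Qed.

(** Reading a point in the chart [i] and going back is the identity, by the
    cocycle property of the changes of covector coordinates. *)
Lemma cotangent_localK (A : Type) (F : X -> 'rV[R]_n -> A) i
    (z : X * 'rV[R]_n) : dom i z.1 ->
  cotangent_local i F (phi i z.1) (covec_coord i z) = F z.1 z.2.
Proof.
move=> di; rewrite /cotangent_local /= phiK//.
have dz := dom_chart_at z.1.
by rewrite covec_change_cocycle// covec_change_id.
Qed.

End Charts.

Section LocalHamiltonian.
Context {R : realType} {n m : nat} (X : manifold R n).
Variables (f : X -> 'rV[R]_m -> 'rV[R]_n) (h : X -> 'rV[R]_m -> 'rV[R]_m).
Hypotheses (hf : Ck_field 2 f) (hh : Ck_fun 2 h).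
Local Notation phase := ('rV[R]_n * 'rV[R]_n * 'rV[R]_m)%type.

(** Coordinates [((q, pi), u)] of position, costate and input. *)
Definition phase_dom (i : chart_index X) : set phase := [set a | (phi i @` dom i) a.1.1].

Definition Hplus_local (i : chart_index X) (a : phase) : R :=
  cotangent_local i (Hplus f h) a.1.1 a.1.2 a.2.

(** Covectors transform by the transposed Jacobians, so that their pairing
    with a tangent vector is the same in every chart. *)
Lemma Hplus_localE i a : Hplus_local i a =
  dotp a.1.2 (field_local i f a.1.1 a.2) + dotp a.2 (h (psi i a.1.1) a.2).
Proof. by rewrite /Hplus_local /cotangent_local /Hplus dotp_covec_change. Qed.

Definition state_input_dom (i : chart_index X) : set ('rV[R]_n * 'rV[R]_m) :=
  [set a | (phi i @` dom i) a.1].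

Lemma state_input_dom_open i : open (state_input_dom i).
Proof.
apply: (@open_comp _ _ fst); last exact: open_phi_dom.
by move=> a _; exact: cvg_fst.
Qed.

Lemma phase_dom_open i : open (phase_dom i).
Proof.
apply: (@open_comp _ _ (fst \o fst)); last exact: open_phi_dom.
move=> a _; apply: continuous_comp; exact: fst_continuous_lin.
Qed.

Lemma Hplus_local_Ck2 i : Ck 2 (phase_dom i) (Hplus_local i).
Proof.
have oD := @phase_dom_open i; have oD' := @state_input_dom_open i.
have linq : linear (fun a : phase => (a.1.1, a.2)) by [].
pose Lq : {linear phase -> ('rV[R]_n * 'rV[R]_m)%type} :=
  HB.pack (fun a : phase => (a.1.1, a.2)) (GRing.isLinear.Build _ _ _ _ _ linq).
have cLq : continuous Lq.
  move=> a; apply: (@cvg_pair _ _ _ _ (nbhs a.1.1) (nbhs a.2)).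
    by apply: continuous_comp; exact: fst_continuous_lin.
  exact: snd_continuous_lin.
have linp : linear (fun a : phase => a.1.2) by [].
pose Lp : {linear phase -> 'rV[R]_n} :=
  HB.pack (fun a : phase => a.1.2) (GRing.isLinear.Build _ _ _ _ _ linp).
have cLp : continuous Lp.
  move=> a; apply: continuous_comp; first exact: fst_continuous_lin.
  exact: snd_continuous_lin.
have CF : Ck 2 (phase_dom i) (fun a : phase => field_local i f a.1.1 a.2).
  exact: (Ck_comp_lin oD' cLq (hf i)).
have Ch : Ck 2 (phase_dom i) (fun a : phase => h (psi i a.1.1) a.2).
  exact: (Ck_comp_lin oD' cLq (hh i)).
have Cp : Ck 2 (phase_dom i) (fun a : phase => a.1.2).
  exact: (Ck_lin 2 (phase_dom i) cLp).
have Cu : Ck 2 (phase_dom i) (fun a : phase => a.2).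
  exact: (@Ck_lin _ _ _ 2 (phase_dom i) snd (@snd_continuous_lin _ _ _)).
have := CkD oD (Ck_dotp oD Cp CF) (Ck_dotp oD Cu Ch).
by apply: eq_Ck => // a _; rewrite Hplus_localE.
Qed.

Lemma Hplus_local_differentiable i a : phase_dom i a ->
  differentiable (Hplus_local i) a.
Proof. by move=> Da; exact: (proj1 (Hplus_local_Ck2 i) a Da). Qed.

Lemma Hplus_localK i (z : X * 'rV[R]_n) u : dom i z.1 ->
  Hplus_local i (phi i z.1, covec_coord i z, u) = Hplus f h z.1 z.2 u.
Proof. by move=> di; rewrite /Hplus_local /= cotangent_localK. Qed.

Lemma grad_costate_Hplus_local i q pi u :
  grad (fun pi' => Hplus_local i (q, pi', u)) pi = field_local i f q u.
Proof.
have -> : (fun pi' => Hplus_local i (q, pi', u)) =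
    (fun pi' => dotp pi' (field_local i f q u) + dotp u (h (psi i q) u)).
  by apply/funext => b; rewrite Hplus_localE.
exact: grad_affine.
Qed.

Lemma dotp_grad_state_Hplus_local i (a : phase) d : phase_dom i a ->
  dotp d (grad (fun q => Hplus_local i (q, a.1.2, a.2)) a.1.1)
    = 'D_(d, 0, 0) (Hplus_local i) a.
Proof.
move=> Da; have dH := Hplus_local_differentiable Da.
have d1 := differentiable_partial1 dH.
have d2 := differentiable_partial1 d1.
rewrite (dotp_grad d d2).
rewrite (derive_partial1 (fun b => Hplus_local i (b, a.2)) a.1 d).
exact: (derive_partial1 (Hplus_local i) a (d, 0)).
Qed.

Lemma dotp_grad_input_Hplus_local i (a : phase) v : phase_dom i a ->
  dotp v (grad (fun u => Hplus_local i (a.1, u)) a.2)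
    = 'D_(0, v) (Hplus_local i) a.
Proof.
move=> Da; have dH := Hplus_local_differentiable Da.
rewrite (dotp_grad v (differentiable_partial2 dH)).
exact: derive_partial2.
Qed.

(** The right-hand side is what Hamilton's equations provide along a solution:
    minus the derivative of the costate, and the output. *)
Lemma derive_Hplus_local i (a : phase) d v : phase_dom i a ->
  'D_(d, 0, v) (Hplus_local i) a
    = dotp d (grad (fun q => Hplus_local i (q, a.1.2, a.2)) a.1.1)
      + dotp v (grad (fun u => Hplus_local i (a.1, u)) a.2).
Proof.
move=> Da; have dH := Hplus_local_differentiable Da.
rewrite (dotp_grad_state_Hplus_local d Da) (dotp_grad_input_Hplus_local v Da).
rewrite !(deriveE _ dH) -linearD; congr ('d _ _ _).
by congr (_, _, _) => /=; rewrite ?addr0 ?add0r.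
Qed.

Lemma grad_Hplus_local i (z : X * 'rV[R]_n) u : dom i z.1 ->
  grad (Hplus f h z.1 z.2) u
    = grad (fun w => Hplus_local i (phi i z.1, covec_coord i z, w)) u.
Proof.
move=> di; have -> // : Hplus f h z.1 z.2 =
  (fun w => Hplus_local i (phi i z.1, covec_coord i z, w)).
by apply/funext => w; rewrite Hplus_localK.
Qed.

End LocalHamiltonian.

(** * Dependence of a trajectory on input and initial state in one chart *)

Section VectorTaylor.
Context {R : realType} {V : normedModType R}.
Hypothesis frV : framed V.

(** Componentwise; the sum of the constants bounds the sup norm. *)
Lemma Ck1_locally_lipschitz_rV k (D : set V) (F : V -> 'rV[R]_k) (a0 : V) :
  open D -> Ck 1 D F -> D a0 -> exists L r : R, [/\ 0 <= L, 0 < r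
  & forall a b, `|a - a0| < r -> `|b - a0| < r ->
      `|F b - F a| <= L * `|b - a|].
Proof.
move=> oD CF Da0.
have /choice[L /choice[r hLr]] : forall j, exists L r : R, [/\ 0 <= L, 0 < r,
    forall a, `|a - a0| < r -> D a
  & forall a b, `|a - a0| < r -> `|b - a0| < r ->
      `|F b 0 j - F a 0 j| <= L * `|b - a|].
  by move=> j; apply: (Ck1_locally_lipschitz frV oD _ Da0); exact: Ck_coord.
exists (\sum_j L j), (\big[Num.min/1]_j r j); split.
- by apply: sumr_ge0 => j _; have [] := hLr j.
- by apply: lt_bigmin => // j _; have [] := hLr j.
move=> a b ar br; have L0 j : 0 <= L j by have [] := hLr j.
apply: rV_norm_le => [|j]; first by rewrite mulr_ge0// sumr_ge0.
rewrite !mxE; have [_ _ _ hL] := hLr j.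
apply: (le_trans (hL a b _ _)).
- exact: lt_le_trans ar (bigmin_le _ _ _).
- exact: lt_le_trans br (bigmin_le _ _ _).
by rewrite ler_wpM2r// (bigD1 j)//= lerDl sumr_ge0.
Qed.

Lemma Ck2_quadratic_remainder_rV k (D : set V) (F : V -> 'rV[R]_k) (a0 : V) :
  open D -> Ck 2 D F -> D a0 -> exists M r : R, [/\ 0 <= M, 0 < r
  & forall a b, `|a - a0| < r -> `|b - a0| < r ->
      `|F b - F a - 'D_(b - a) F a| <= M * `|b - a| ^+ 2].
Proof.
move=> oD CF Da0.
have /choice[L /choice[r hLr]] : forall j, exists L r : R, [/\ 0 <= L, 0 < r,
    forall a, `|a - a0| < r -> D a
  & forall a b, `|a - a0| < r -> `|b - a0| < r ->
      `|F b 0 j - F a 0 j - 'D_(b - a) (fun c => F c 0 j) a|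
        <= L * `|b - a| ^+ 2].
  by move=> j; apply: (Ck2_quadratic_remainder frV oD _ Da0); exact: Ck_coord.
have [r1 r1_gt0 hr1] := near_ball_radius (open_nbhs_nbhs (conj oD Da0)).
exists (\sum_j L j), (Num.min (\big[Num.min/1]_j r j) r1); split.
- by apply: sumr_ge0 => j _; have [] := hLr j.
- by rewrite lt_min r1_gt0 andbT; apply: lt_bigmin => // j _; have [] := hLr j.
move=> a b; rewrite !lt_min => /andP[ar ar1] /andP[br _].
have L0 j : 0 <= L j by have [] := hLr j.
have dF : differentiable F a := CF.1 a (hr1 _ ar1).
apply: rV_norm_le => [|j]; first by rewrite mulr_ge0 ?sqr_ge0// sumr_ge0.
rewrite (derive_mx (diff_derivable dF)) !mxE; have [_ _ _ hL] := hLr j.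
apply: (le_trans (hL a b _ _)).
- exact: lt_le_trans ar (bigmin_le _ _ _).
- exact: lt_le_trans br (bigmin_le _ _ _).
by rewrite ler_wpM2r ?sqr_ge0// (bigD1 j)//= lerDl sumr_ge0.
Qed.

End VectorTaylor.

Lemma distance_continuous (R : realType) (V : normedModType R) (v0 : V) :
  continuous (fun v : V => `|v - v0|).
Proof.
move=> v; apply: cvg_norm; apply: cvgB; last exact: cvg_cst.
exact: cvg_id.
Qed.

Section ChartTrajectories.
Context {R : realType} {n m : nat} (X : manifold R n).

Lemma cvg_chart (T : Type) (FF : set_system T) (fFF : Filter FF) (x : T -> X) x0
    (i : chart_index X) :
  x s @[s --> FF] --> x0 -> dom i x0 -> phi i (x s) @[s --> FF] --> phi i x0.
Proof. by move=> cx di; exact: (cvg_comp _ _ cx (phi_continuous di)). Qed.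

Lemma within_chart_continuous (a b : R) (x : R -> X) (i : chart_index X) :
  {within `[a, b], continuous x} -> (forall t, t \in `[a, b] -> dom i (x t)) ->
  {within `[a, b], continuous (fun t => phi i (x t))}.
Proof.
move=> /within_itvP cx di; apply/within_itvP => t tab.
by apply: cvg_chart; [exact: cx|exact: di].
Qed.

Lemma chart_ball_open (i : chart_index X) q0 (r : R) :
  open [set x : X | dom i x /\ `|phi i x - q0| < r].
Proof.
rewrite openE => x [di xr]; rewrite /interior.
apply: filterI; first exact: near_dom.
have cn : `|phi i y - q0| @[y --> x] --> `|phi i x - q0|.
  apply: cvg_norm; apply: cvgB; last exact: cvg_cst.
  exact: phi_continuous.
exact: (cvgr_lt _ cn).
Qed.

(** It is compact, as the image of a compact ball, and the manifold is
    Hausdorff. *)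
Lemma chart_closed_ball_closed (i : chart_index X) q0 (r : R) :
  (forall q, `|q - q0| <= r -> (phi i @` dom i) q) ->
  closed (psi i @` [set q | `|q - q0| <= r]).
Proof.
move=> hr; apply: compact_closed; first exact: pt_hausdorff.
apply: continuous_compact.
  by apply/subspace_continuousP => q /hr Dq; apply: cvg_within_filter;
     exact: psi_continuous.
apply: bounded_closed_compact.
  exists (r + `|q0|); split; first exact: num_real.
  move=> c rc q /= qr; apply: ltW; apply: le_lt_trans rc.
  by rewrite -[q](subrK q0) (le_trans (ler_normD _ _))// lerD2r.
rewrite (_ : [set q | _] = (fun q => `|q - q0|) @^-1` [set c | c <= r]) //.
apply: closed_comp; [move=> q _; exact: distance_continuous|exact: closed_le].

Qed.

Variables (f : X -> 'rV[R]_m -> 'rV[R]_n) (h : X -> 'rV[R]_m -> 'rV[R]_m).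

(** Gronwall's inequality for [dotp E E], where [E] is the difference of the
    two trajectories in coordinates, is available only while [x'] stays
    in the chart. The bound [beta] it gives is at most [r / 4], so it
    confines [x'] to a closed ball well inside the open ball of radius [r];
    the barrier lemma then shows that [x'] never leaves the chart. *)
Lemma chart_dependence (i : chart_index X) q0 u0 (L r T a b eta eps beta : R)
    (u u' : R -> 'rV[R]_m) (x x' : R -> X) (y y' : R -> 'rV[R]_m) :
  (forall q, `|q - q0| < r -> (phi i @` dom i) q) -> 0 <= L ->
  (forall c d, `|c - (q0, u0)| < r -> `|d - (q0, u0)| < r ->
     `|field_local i f d.1 d.2 - field_local i f c.1 c.2| <= L * `|d - c|) ->
  sigma f h 0 T u x y -> sigma f h 0 T u' x' y' -> 0 <= a -> b <= T ->
  (forall t, t \in `[a, b] -> [/\ dom i (x t), `|phi i (x t) - q0| < r / 2,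
     `|u t - u0| < r, `|u' t - u0| < r & `|u' t - u t| <= eps]) ->
  dom i (x' a) -> `|phi i (x' a) - phi i (x a)| <= eta ->
  eta <= beta -> beta <= r / 4 ->
  (n%:R * eta ^+ 2 + eps ^+ 2) * expR (2 * n%:R * L * (b - a)) <= beta ^+ 2 ->
  forall t, t \in `[a, b] ->
    dom i (x' t) /\ `|phi i (x' t) - phi i (x t)| <= beta.
Proof.
move=> Dr L0 lipF [_ cx hx _] [_ cx' hx' _] a0 bT base dax' etaa eta_beta beta_le hbeta.
have beta0 : 0 <= beta by rewrite (le_trans _ eta_beta)// (le_trans _ etaa).
have sub t : t \in `[a, b] -> t \in `[0, T].
  by rewrite !in_itv /= => /andP[at_ tb]; rewrite (le_trans a0)// (le_trans tb).
pose O := [set p : X | dom i p /\ `|phi i p - q0| < r].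
pose K := psi i @` [set q | `|q - q0| <= 3 / 4 * r].
pose E t := phi i (x' t) - phi i (x t).
have gron t : t \in `[a, b] -> (forall s, s \in `[a, t] -> O (x' s)) ->
    `|E t| <= beta.
  move=> tab Ot; have [at_ tb] : a <= t /\ t <= b.
    by move: tab; rewrite in_itv => /andP.
  have subt s : s \in `[a, t] -> s \in `[a, b].
    by rewrite !in_itv /= => /andP[-> /le_trans]; apply.
  have cE : {within `[a, t], continuous E}.
    have c1 : {within `[a, t], continuous x}.
      by apply: continuous_subspaceW cx => s /subt/sub.
    have c2 : {within `[a, t], continuous x'}.
      by apply: continuous_subspaceW cx' => s /subt/sub.
    have /within_itvP c3 : {within `[a, t], continuous (fun s => phi i (x s))}.
      by apply: within_chart_continuous => // s /subt/base[].
    have /within_itvP c4 : {within `[a, t], continuous (fun s => phi i (x' s))}.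
      by apply: within_chart_continuous => // s /Ot[].
    by apply/within_itvP => s sat; apply: cvgB; [exact: c4|exact: c3].
  pose F s := field_local i f (phi i (x' s)) (u' s)
            - field_local i f (phi i (x s)) (u s).
  have dE s : s \in `]a, t[ -> is_derive s 1 E (F s).
    move=> sat; have sat' : s \in `[a, t] by exact: subset_itv_oo_cc.
    have s0T : s \in `]0, T[.
      move: sat; rewrite !in_itv /= => /andP[as_ st].
      by rewrite (le_lt_trans a0)//= (lt_le_trans st)// (le_trans tb).
    have [dx _ _ _ _] := base _ (subt _ sat'); have [dx' _] := Ot _ sat'.
    rewrite /F /field_local !phiK//.
    by apply: is_deriveB; [exact: hx'|exact: hx].
  have de s : s \in `]a, t[ ->
      is_derive s 1 (fun s => dotp (E s) (E s)) (2 * dotp (E s) (F s)).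
    move=> sat; apply: (is_derive_eq (is_derive_dotp (dE s sat) (dE s sat))).
    by rewrite [dotp (F s) _]dotpC mulr_natl mulr2n.
  have ce : {within `[a, t], continuous (fun s => dotp (E s) (E s))}.
    move/within_itvP : cE => cE; apply/within_itvP => s sat.
    by apply: cvg_dotp; exact: cE.
  have le s : s \in `]a, t[ -> 2 * dotp (E s) (F s) <=
      2 * n%:R * L * (dotp (E s) (E s) + eps ^+ 2).
    move=> sat; have sat' : s \in `[a, t] by exact: subset_itv_oo_cc.
    have [dx xr ur u'r uu'] := base _ (subt _ sat'); have [dx' x'r] := Ot _ sat'.
    have r_gt0 : 0 < r by exact: le_lt_trans ur.
    have eps0 : 0 <= eps by exact: le_trans uu'.
    have FL : `|F s| <= L * Num.max `|E s| eps.
      apply: (le_trans (lipF (phi i (x s), u s) (phi i (x' s), u' s) _ _)).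
      - rewrite prod_normE /= gt_max ur andbT (lt_trans xr)//.
        by rewrite ltr_pdivrMr// ltr_pMr// ltr1n.
      - by rewrite prod_normE /= gt_max u'r andbT.
      rewrite ler_wpM2l// prod_normE /= ge_max le_max lexx /=.
      by rewrite le_max uu' orbT.
    rewrite -!mulrA ler_wpM2l//; apply: (le_trans (ler_norm _)).
    apply: (le_trans (dotp_norm_le _ _)); rewrite ler_wpM2l//.
    apply: (@le_trans _ _ (L * (`|E s| ^+ 2 + eps ^+ 2))); last first.
      by rewrite ler_wpM2l// lerD2r sqr_norm_le_dotp.
    apply: (le_trans (ler_wpM2l (normr_ge0 _) FL)).
    rewrite mulrCA ler_wpM2l//.
    (* The product of [`|E s|] with the maximum of [`|E s|] and [eps] is at most
       the sum of their squares. *)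
    have [le1|lt1] := leP `|E s| eps; last first.
      by rewrite -expr2 lerDl sqr_ge0.
    by rewrite (@le_trans _ _ (eps * eps)) ?ler_wpM2r// -expr2 lerDr sqr_ge0.
  have := gronwall at_ ce de le.
  have r_gt0 : 0 < r.
    by have [_ _ ur _ _] := base _ tab; exact: le_lt_trans ur.
  move=> g1; have : `|E t| ^+ 2 <= beta ^+ 2.
    apply: le_trans hbeta; apply: (le_trans (sqr_norm_le_dotp _)).
    apply: (@le_trans _ _ (dotp (E t) (E t) + eps ^+ 2)).
      by rewrite lerDl sqr_ge0.
    apply: (le_trans g1); apply: ler_pM => //.
    - by rewrite addr_ge0 ?sqr_ge0// (le_trans (sqr_ge0 _) (sqr_norm_le_dotp _)).
    - rewrite lerD2r; apply: (le_trans (ler_norm _)).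
      apply: (le_trans (dotp_norm_le _ _)); rewrite ler_wpM2l// -expr2.
      by rewrite ler_pXn2r ?nnegrE// (le_trans _ etaa).
    rewrite ler_expR ler_wpM2l ?lerD2r//.
    by rewrite !mulr_ge0.
  by rewrite ler_pXn2r ?nnegrE.
have hOK t : t \in `[a, b] -> (forall s, s \in `[a, t] -> O (x' s)) -> K (x' t).
  move=> tab Ot; have Et := gron t tab Ot.
  have at_ : a <= t by move: tab; rewrite in_itv => /andP[].
  have [dx' _] : O (x' t) by apply: Ot; rewrite in_itv /= at_ lexx.
  exists (phi i (x' t)); last by rewrite phiK.
  have [_ xr _ _ _] := base _ tab.
  rewrite /= -[phi i (x' t)](subrK (phi i (x t))) -addrA.
  apply: (le_trans (ler_normD _ _)).
  rewrite -/(E t); lra.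
move=> t tab; have ab : a <= b.
  by move: tab; rewrite in_itv => /andP[]; exact: le_trans.
have aab : a \in `[a, b] by rewrite in_itv /= lexx ab.
have r_gt0 : 0 < r.
  by have [_ _ ur _ _] := base _ tab; exact: le_lt_trans ur.
have KO : K `<=` O.
  move=> _ [q /= qr <-]; have qr' : `|q - q0| < r by lra.
  by have [d1 e1] := psi_phi_dom (Dr _ qr'); split=> //; rewrite e1.
have Kall : forall s, s \in `[a, b] -> K (x' s).
  apply: (@barrier R X a b x' O K) => //.
  - by apply: continuous_subspaceW cx' => s /sub.
  - exact: chart_ball_open.
  - apply: chart_closed_ball_closed => q qr; apply: Dr; lra.
  exists (phi i (x' a)); last by rewrite phiK.
  have [_ xr _ _ _] := base _ aab.
  rewrite /= -[phi i (x' a)](subrK (phi i (x a))) -addrA.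
  apply: (le_trans (ler_normD _ _)).
  lra.
have Oall s : s \in `[a, t] -> O (x' s).
  rewrite in_itv /= => /andP[as_ st]; apply/KO/Kall; rewrite in_itv /= as_ /=.
  by rewrite (le_trans st)//; move: tab; rewrite in_itv => /andP[].
split; last exact: gron.
by have [] := KO _ (Kall t tab).
Qed.

End ChartTrajectories.

(** * First-order variation of a family of trajectories *)

Section Variation.
Context {R : realType} {n m : nat} (X : manifold R n).
Variables (f : X -> 'rV[R]_m -> 'rV[R]_n) (h : X -> 'rV[R]_m -> 'rV[R]_m).
Hypotheses (hf : Ck_field 2 f) (hh : Ck_fun 2 h).

Lemma sigma_plus_sigma a b u z y : sigma_plus f h a b u z y ->
  sigma f h a b u (fun t => (z t).1) (fun t => h (z t).1 (u t)).
Proof.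
move=> [[cu [cx _] hz] _]; split => // t tab i di.
have [+ _] := hz t tab i di.
by rewrite (grad_costate_Hplus_local f h) /field_local phiK.
Qed.

Lemma near0_mul_lt (C r : R) : 0 < r -> \forall s \near (0 : R), C * `|s| < r.
Proof.
move=> r0; have c : C * `|s| @[s --> (0 : R)] --> C * `|0 : R|.
  by apply: cvgM; [exact: cvg_cst|apply: cvg_norm; exact: cvg_id].
by apply: (cvgr_lt _ c); rewrite normr0 mulr0.
Qed.

Variables (T : R) (u : R -> 'rV[R]_m) (z : R -> X * 'rV[R]_n)
  (yp : R -> 'rV[R]_m) (v : R -> 'rV[R]_m).
Hypothesis T_gt0 : 0 < T.
Hypothesis hz : sigma_plus f h 0 T u z yp.
Hypothesis cv : {within `[0, T], continuous v}.
Variables (xs : R -> R -> X) (ys : R -> R -> 'rV[R]_m).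
Hypothesis hxs : forall s,
  sigma f h 0 T (fun t => u t + s *: v t) (xs s) (ys s).
Hypothesis xs0 : forall s, xs s 0 = (z 0).1.
Variable r : R -> R -> R.
Hypothesis r0 : forall s, r s 0 = 0.
Hypothesis cr : forall s, {within `[0, T], continuous (r s)}.
Hypothesis dr : forall s t, t \in `]0, T[ -> is_derive t 1 (r s)
  (dotp (u t + s *: v t) (h (xs s t) (u t + s *: v t))
   - dotp (u t) (h (z t).1 (u t)) - s * dotp (v t) (yp t)).

Definition gap i s t : 'rV[R]_n := phi i (xs s t) - phi i (z t).1.

(** The family [xs s] solves the control system with input [u + s v] and starts
    from the same state as the base solution [z]. The function [r s] is the
    part of the cost up to time [t] that the expected first-order term does
    not explain. By itself it is only of order [s]; adding the pairing of
    the costate with the displacement makes it quadratic in [s], because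
    the derivative of the sum is the second-order Taylor remainder of the
    Hamiltonian. *)
Definition corrected_remainder i s t : R :=
  r s t + dotp (covec_coord i (z t)) (gap i s t).

(** The property propagated along the base solution. The estimates are
    quadratic in [s], so that the error made when the chart changes, which is
    quadratic in the displacement, is absorbed by the constant. *)
Definition tracked_in i t : Prop := exists C : R, \forall s \near 0,
  [/\ dom i (xs s t), `|gap i s t| <= C * `|s|
    & `|corrected_remainder i s t| <= C * s ^+ 2].

(** The displacement in the chart [j] is, up to a quadratic error, the image
    of the displacement in the chart [i] under the Jacobian of the transition,
    and the covector rule makes the two pairings agree at first order. *)
Lemma tracked_in_change i j t : dom i (z t).1 -> dom j (z t).1 ->
  tracked_in i t -> tracked_in j t.
Proof.
move=> di dj [C hC].
have oW := @overlap_open R n X i j.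
have Wq : (phi i @` (dom i `&` dom j)) (phi i (z t).1) by exists (z t).1.
have [L [r1 [L0 r1_gt0 hL]]] := Ck1_locally_lipschitz_rV (framed_rV n) oW
  (transition_Ck i j 1) Wq.
have [M [r2 [M0 r2_gt0 hM]]] := Ck2_quadratic_remainder_rV (framed_rV n) oW
  (transition_Ck i j 2) Wq.
have [r3 r3_gt0 hW] := near_ball_radius (open_nbhs_nbhs (conj oW Wq)).
set pj := covec_coord j (z t); set q := phi i (z t).1 in hL hM hW.
exists (`|C| + L * `|C| + n%:R * (`|pj| * (M * `|C| ^+ 2))).
have small := near0_mul_lt `|C|.
near=> s.
have [dis gs ds] : [/\ dom i (xs s t), `|gap i s t| <= C * `|s|
    & `|corrected_remainder i s t| <= C * s ^+ 2] by near: s.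
have gs' : `|gap i s t| <= `|C| * `|s|.
  by rewrite (le_trans gs)// ler_wpM2r// ler_norm.
have ds' : `|corrected_remainder i s t| <= `|C| * s ^+ 2.
  by rewrite (le_trans ds)// ler_wpM2r ?sqr_ge0// ler_norm.
have s1 : `|gap i s t| < r1 by apply: le_lt_trans gs' _; near: s; exact: small.
have s2 : `|gap i s t| < r2 by apply: le_lt_trans gs' _; near: s; exact: small.
have s3 : `|gap i s t| < r3 by apply: le_lt_trans gs' _; near: s; exact: small.
have djs : dom j (xs s t).
  have [x' [dix djx] e] := hW _ s3.
  by rewrite -(phiK dis) -e phiK.
have gjE : gap j s t = (phi j \o psi i) (phi i (xs s t)) - (phi j \o psi i) q.
  by rewrite !transitionE.
have gj : `|gap j s t| <= L * `|C| * `|s|.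
  rewrite gjE; apply: (le_trans (hL q _ _ s1)); first by rewrite subrr normr0.
  by rewrite -mulrA ler_wpM2l.
have pair_change : dotp (covec_coord i (z t)) (gap i s t) =
    dotp pj ('D_(gap i s t) (phi j \o psi i) q).
  have -> : 'D_(gap i s t) (phi j \o psi i) q = vec_change i j (z t).1 (gap i s t).
    exact: (deriveEjacobian _ (transition_differentiable di dj)).
  have piE : covec_change j i (z t).1 pj = covec_coord i (z t).
    exact: covec_coord_change.
  exact: (etrans (congr1 (fun p => dotp p _) (esym piE))
    (dotp_covec_change j i (z t).1 pj (gap i s t))).
have taylor : `|dotp pj (gap j s t - 'D_(gap i s t) (phi j \o psi i) q)| <=
    n%:R * (`|pj| * (M * `|C| ^+ 2)) * s ^+ 2.
  apply: (le_trans (dotp_norm_le _ _)).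
  rewrite -!mulrA ler_wpM2l// ler_wpM2l// gjE.
  apply: (le_trans (hM q _ _ s2)); first by rewrite subrr normr0.
  rewrite ler_wpM2l// mulrA -expr2 -[s ^+ 2]real_normK ?num_real// -exprMn.
  by rewrite ler_pXn2r ?nnegrE// mulr_ge0.
split => //.
  apply: (le_trans gj); rewrite ler_wpM2r// addrAC lerDr.
  by rewrite addr_ge0// !mulr_ge0// sqr_ge0.
have -> : corrected_remainder j s t = corrected_remainder i s t
    + dotp pj (gap j s t - 'D_(gap i s t) (phi j \o psi i) q).
  have shift_add (a b c : R) : a + c = a + b + (c - b) by ring.
  have e := dotpBr pj (gap j s t) ('D_(gap i s t) (phi j \o psi i) q).
  rewrite -pair_change in e; rewrite e.
  exact: shift_add.
apply: (le_trans (ler_normD _ _)).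
apply: (le_trans (lerD ds' taylor)).
rewrite -mulrDl ler_wpM2r ?sqr_ge0// lerD2r lerDl.
by rewrite mulr_ge0.
Unshelve. all: by end_near. Qed.

(** Around [t] a single chart suffices. Trajectories differ by [O(s)] there by
    Gronwall's inequality, and Hamilton's equations turn the derivative of
    the corrected remainder into
    [H b - H a - 'D_(b - a) H a] with [b - a] the displacement in position and
    input, the costate being the same; this is [O(s ^+ 2)]. *)
Lemma tracked_in_step i t : t \in `[0, T] -> dom i (z t).1 ->
  exists2 d : R, 0 < d & forall a b, 0 <= a -> a <= b -> b <= T ->
    `|a - t| < d -> `|b - t| < d ->
    [/\ dom i (z a).1, dom i (z b).1 & tracked_in i a -> tracked_in i b].
Proof.
move=> t0T di.
have [[/within_itvP cu [/within_itvP cx cp] dz] ypE] := hz.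
have sz := sigma_plus_sigma hz.
set q := phi i (z t).1; set pi := covec_coord i (z t).
have Dq : (phi i @` dom i) q by exact: phi_dom.
have [L [r1 [L0 r1_gt0 hL]]] := Ck1_locally_lipschitz_rV
  (framed_prod (framed_rV n) (framed_rV m)) (@state_input_dom_open R n m X i)
  (CkS (hf i)) (Dq : state_input_dom (m:=m) i (q, u t)).
have [M [r2 [M0 r2_gt0 hD hM]]] := Ck2_quadratic_remainder
  (framed_prod (framed_prod (framed_rV n) (framed_rV n)) (framed_rV m))
  (@phase_dom_open R n m X i) (Hplus_local_Ck2 hf hh i)
  (Dq : phase_dom (m:=m) i (q, pi, u t)).
have [r3 r3_gt0 hDq] := near_ball_radius
  (open_nbhs_nbhs (conj (@open_phi_dom _ _ X i) Dq)).
pose rho := Num.min (Num.min r1 r2) r3.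
have rho_gt0 : 0 < rho by rewrite !lt_min r1_gt0 r2_gt0.
have rho1 : rho <= r1 by rewrite !ge_min lexx.
have rho2 : rho <= r2 by rewrite !ge_min lexx orbT.
have rho3 : rho <= r3 by rewrite !ge_min lexx !orbT.
have rho_half : 0 < rho / 2 by rewrite divr_gt0.
have [d d_gt0 hd] : exists2 d : R, 0 < d &
    forall s, s \in `[0, T] -> `|s - t| < d ->
      [/\ dom i (z s).1, `|phi i (z s).1 - q| < rho / 2,
          `|covec_coord i (z s) - pi| < rho, `|u s - u t| < rho / 2
        & `|v s| <= `|v t| + 1].
  apply: near_within_itv.
  have n1 : \forall s \near within `[0, T] (nbhs t), dom i (z s).1.
    by apply: (cx t t0T (dom i)); exact: near_dom.
  have n2 : \forall s \near within `[0, T] (nbhs t), `|phi i (z s).1 - q| < rho / 2.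
    have c : phi i (z s).1 @[s --> within `[0, T] (nbhs t)] --> q.
      by apply: cvg_chart; [exact: cx|exact: di].
    by apply: (cvgr_distC_lt _ _ c).
  have n3 : \forall s \near within `[0, T] (nbhs t),
      `|covec_coord i (z s) - pi| < rho.
    exact: (cvgr_distC_lt _ _ (cp t t0T i di) _ rho_gt0).
  have n4 : \forall s \near within `[0, T] (nbhs t), `|u s - u t| < rho / 2.
    exact: (cvgr_distC_lt _ _ (cu t t0T) _ rho_half).
  have n5 : \forall s \near within `[0, T] (nbhs t), `|v s| <= `|v t| + 1.
    move/within_itvP : cv => cv'.
    by apply: (cvgr_norm_le _ (cv' t t0T)); rewrite ltrDl.
  rewrite !near_withinE in n1 n2 n3 n4 n5 *.
  near=> s => s0T.
  by split; move: s0T; near: s; [exact: n1|exact: n2|exact: n3|exact: n4|exact: n5].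
exists d => // a b a0 ab bT ad bd.
have inab s : s \in `[a, b] -> s \in `[0, T].
  by rewrite !in_itv /= => /andP[as_ sb]; rewrite (le_trans a0)//= (le_trans sb).
have base s : s \in `[a, b] ->
      [/\ dom i (z s).1, `|phi i (z s).1 - q| < rho / 2,
          `|covec_coord i (z s) - pi| < rho, `|u s - u t| < rho / 2
        & `|v s| <= `|v t| + 1].
  move=> sab; apply: hd; first exact: inab.
  move: sab; rewrite in_itv /= => /andP[as_ sb].
  by move: ad bd; rewrite !ltr_norml => /andP[h1 _] /andP[_ h2]; lra.
have aab : a \in `[a, b] by rewrite in_itv /= lexx.
have bab : b \in `[a, b] by rewrite in_itv /= lexx ab.
split; [by have [] := base a aab|by have [] := base b bab|].
move=> [C hC].
pose V := `|v t| + 1; have V0 : 0 <= V by rewrite addr_ge0.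
(* The summand [`|C|] of [B] dominates the initial displacement, and the
   square root is the constant that Gronwall's inequality yields. *)
pose B := `|C| + Num.sqrt ((n%:R * `|C| ^+ 2 + V ^+ 2)
                            * expR (2 * n%:R * L * (b - a))).
have B0 : 0 <= B by rewrite addr_ge0// sqrtr_ge0.
exists (`|C| + B + M * (B + V) ^+ 2 * (b - a)).
near=> s.
have [das gs ds] : [/\ dom i (xs s a), `|gap i s a| <= C * `|s|
    & `|corrected_remainder i s a| <= C * s ^+ 2] by near: s.
have gs' : `|gap i s a| <= `|C| * `|s|.
  by rewrite (le_trans gs)// ler_wpM2r// ler_norm.
have ds' : `|corrected_remainder i s a| <= `|C| * s ^+ 2.
  by rewrite (le_trans ds)// ler_wpM2r ?sqr_ge0// ler_norm.
have sV : V * `|s| < rho / 2 by near: s; exact: near0_mul_lt.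
have sB : B * `|s| < rho / 4.
  by near: s; apply: near0_mul_lt; rewrite divr_gt0.
have us t' : t' \in `[a, b] ->
    `|u t' + s *: v t' - u t'| <= V * `|s| /\ `|u t' + s *: v t' - u t| < rho.
  move=> tab; have [_ _ _ ut vt] := base t' tab.
  have sv : `|s *: v t'| <= V * `|s| by rewrite normrZ mulrC ler_wpM2r.
  split; first by rewrite addrAC subrr add0r.
  rewrite addrAC; apply: (le_lt_trans (ler_normD _ _)); lra.
have dep t' : t' \in `[a, b] ->
    dom i (xs s t') /\ `|phi i (xs s t') - phi i (z t').1| <= B * `|s|.
  apply: (@chart_dependence R n m X f h i q (u t) L rho T a b (`|C| * `|s|)
    (V * `|s|) (B * `|s|) u (fun t => u t + s *: v t) (fun t => (z t).1)
    (xs s) _ (ys s) _ L0 _ sz) => //.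
  - by move=> q' hq'; apply: hDq; exact: lt_le_trans rho3.
  - move=> c c' hc hc'; apply: hL; exact: lt_le_trans rho1.
  - move=> t1 tab; have [dit qt _ ut _] := base t1 tab.
    have [u1 u2] := us t1 tab; split => //.
    by rewrite (lt_trans ut)// ltr_pdivrMr// ltr_pMr// ltr1n.
  - by rewrite ler_wpM2r// lerDl sqrtr_ge0.
  - exact: ltW.
  rewrite !exprMn mulrA -mulrDl mulrAC ler_wpM2r ?sqr_ge0//.
  rewrite -[leLHS]sqr_sqrtr; last first.
    by rewrite mulr_ge0 ?expR_ge0// addr_ge0 ?mulr_ge0 ?sqr_ge0.
  by rewrite ler_pXn2r ?nnegrE ?sqrtr_ge0// lerDr.
pose base_pt t' := (phi i (z t').1, covec_coord i (z t'), u t').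
pose end_pt t' := (phi i (xs s t'), covec_coord i (z t'), u t' + s *: v t').
pose H := Hplus_local f h i.
pose dG t' := H (end_pt t') - H (base_pt t')
  - 'D_(end_pt t' - base_pt t') H (base_pt t').
have dptE t' : end_pt t' - base_pt t' = (gap i s t', 0, s *: v t').
  rewrite /end_pt /base_pt /gap; congr (_, _, _); first exact: subrr.
  by rewrite /= addrAC subrr add0r.
have dG_le t' : t' \in `[a, b] -> `|dG t'| <= M * (B + V) ^+ 2 * s ^+ 2.
  move=> tab; have [dit qt pt ut vt] := base t' tab.
  have [dis gap_le] := dep t' tab; have [u1 u2] := us t' tab.
  have lt2 : rho / 2 < rho by rewrite ltr_pdivrMr// ltr_pMr// ltr1n.
  apply: (le_trans (hM _ _ _ _)).
  - rewrite !prod_normE /= !gt_max !(lt_le_trans _ rho2)// ?(lt_trans _ lt2)//.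
  - rewrite !prod_normE /= !gt_max !(lt_le_trans _ rho2)//.
    rewrite -[phi i (xs s t')](subrK (phi i (z t').1)) -addrA.
    apply: (le_lt_trans (ler_normD _ _)); lra.
  rewrite -mulrA ler_wpM2l// -[s ^+ 2]real_normK ?num_real// -exprMn.
  rewrite ler_pXn2r ?nnegrE ?mulr_ge0 ?addr_ge0//.
  rewrite dptE !prod_normE /= normr0 !ge_max mulrDl.
  rewrite (le_trans gap_le) ?lerDl ?mulr_ge0//=.
  rewrite addr_ge0 ?mulr_ge0//= (@le_trans _ _ (V * `|s|))//; last first.
    by rewrite lerDr mulr_ge0.
  by rewrite normrZ mulrC ler_wpM2r.
have cG : {within `[a, b], continuous (corrected_remainder i s)}.
  have subab : `[a, b] `<=` `[0, T] by move=> t' /inab.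
  have [_ cxs _ _] := hxs s.
  have /within_itvP c1 : {within `[a, b], continuous (fun t => phi i (z t).1)}.
    apply: within_chart_continuous => [|t' /base[]//].
    by apply: continuous_subspaceW subab _; exact/within_itvP.
  have /within_itvP c2 : {within `[a, b], continuous (fun t => phi i (xs s t))}.
    apply: within_chart_continuous => [|t' /dep[]//].
    exact: continuous_subspaceW subab cxs.
  have /within_itvP c3 : {within `[a, b], continuous (r s)}.
    exact: (continuous_subspaceW subab (@cr s)).
  apply/within_itvP => t' tab; apply: cvgD; first exact: c3.
  apply: cvg_dotp; last by apply: cvgB; [exact: c2|exact: c1].
  have [dit _ _ _ _] := base t' tab.
  apply: cvg_trans (cp t' (inab _ tab) i dit).
  by apply: cvg_app; exact: within_subset.
have dGE t' : t' \in `]a, b[ -> is_derive t' 1 (corrected_remainder i s) (dG t').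
  move=> tab; have tab' : t' \in `[a, b] by exact: subset_itv_oo_cc.
  have t0T' : t' \in `]0, T[.
    move: tab; rewrite !in_itv /= => /andP[at_ tb].
    by rewrite (le_lt_trans a0)//= (lt_le_trans tb).
  have [dit _ _ _ _] := base t' tab'; have [dis _] := dep t' tab'.
  have Dt : phase_dom (m:=m) i (base_pt t') by exact: phi_dom.
  pose w := u t' + s *: v t'.
  pose Fs := vec_change (chart_at (xs s t')) i (xs s t') (f (xs s t') w).
  pose F0 := vec_change (chart_at (z t').1) i (z t').1 (f (z t').1 (u t')).
  pose gq := grad (fun q' => H (q', covec_coord i (z t'), u t')) (phi i (z t').1).
  have [_ dp] := dz t' t0T' i dit.
  have [_ _ dx _] := sz; have dq : is_derive t' 1 (fun t => phi i (z t).1) F0.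
    exact: dx.
  have [_ _ dxs _] := hxs s.
  have dq' : is_derive t' 1 (fun t => phi i (xs s t)) Fs by exact: dxs.
  have dG1 := is_deriveD (dr s t0T') (is_derive_dotp dp (is_deriveB dq' dq)).
  apply: (is_derive_eq dG1).
  have HsE : H (end_pt t') = dotp (covec_coord i (z t')) Fs + dotp w (h (xs s t') w).
    by rewrite /H Hplus_localE /field_local /= !phiK.
  have H0E : H (base_pt t') =
      dotp (covec_coord i (z t')) F0 + dotp (u t') (h (z t').1 (u t')).
    by rewrite /H Hplus_localE /field_local /= !phiK.
  have DHE : 'D_(gap i s t', 0, s *: v t') H (base_pt t') =
      dotp (gap i s t') gq + s * dotp (v t') (yp t').
    rewrite (derive_Hplus_local hf hh _ _ Dt) dotpZl.
    by rewrite (ypE t' (inab _ tab')) (grad_Hplus_local f h (u t') dit).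
  change (dotp w (h (xs s t') w) - dotp (u t') (h (z t').1 (u t'))
    - s * dotp (v t') (yp t') + (dotp (- gq) (gap i s t')
    + dotp (covec_coord i (z t')) (Fs - F0)) = dG t').
  rewrite /dG dptE HsE H0E DHE dotpBr dotpNl (dotpC (gap i s t')).
  have regroup (c1 c2 c3 c4 c5 c6 : R) : c1 - c2 - c3 + (- c4 + (c5 - c6)) =
    c5 + c1 - (c6 + c2) - (c4 + c3) by ring.
  exact: regroup.
have [dbs gb] := dep b bab.
split => //.
  apply: (le_trans gb); rewrite ler_wpM2r// addrAC lerDr addr_ge0//.
  by apply: mulr_ge0; [rewrite mulr_ge0 ?sqr_ge0|rewrite subr_ge0].
have := norm_le_of_derive ab cG dGE dG_le.
move=> Gle; rewrite -[corrected_remainder i s b](subrK (corrected_remainder i s a)).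
apply: (le_trans (ler_normD _ _)); apply: (le_trans (lerD Gle ds')).
rewrite addrC mulrAC -mulrDl ler_wpM2r ?sqr_ge0// lerD2r lerDl //.
Unshelve. all: by end_near. Qed.

(** Real induction carries the estimate from [0], where the displacement
    vanishes, to [T], where the costate vanishes and the correction term
    with it. *)
Lemma family_quadratic_bound : (z T).2 = 0 ->
  exists C : R, \forall s \near 0, `|r s T| <= C * s ^+ 2.
Proof.
move=> pT.
(* The chart is quantified inside the induction predicate, since it changes
   along the base solution. *)
have [i [_ [C hC]]] : exists i, dom i (z T).1 /\ tracked_in i T.
  apply: (@real_induction R 0 T (fun t => exists i, dom i (z t).1 /\ tracked_in i t)).
  - exact: ltW.
  - exists (chart_at (z 0).1); split; first exact: dom_chart_at.
    exists 0; near=> s; rewrite /corrected_remainder /gap xs0 subrr normr0 !mul0r.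
    by rewrite dotp0r r0 addr0 normr0; split => //; exact: dom_chart_at.
  move=> t t0T; have di := dom_chart_at (z t).1.
  have [d d0 hd] := tracked_in_step t0T di.
  exists d => // a b a0 ab bT ad bd [j [dj hj]].
  have [dia dib step] := hd a b a0 ab bT ad bd.
  by exists (chart_at (z t).1); split => //; apply: step; exact: tracked_in_change hj.
exists C; apply: filterS hC => s [_ _].
by rewrite /corrected_remainder /covec_coord pT /covec_change mul0mx dotp0l addr0.
Unshelve. all: by end_near. Qed.

End Variation.

(** * Continuity of outputs and the inverse system *)

Lemma cvg_row (R : realType) (T : Type) (FF : set_system T) (fFF : Filter FF) k
    (F : T -> 'rV[R]_k) (w : 'rV[R]_k) :
  (forall j, F s 0 j @[s --> FF] --> w 0 j) -> F s @[s --> FF] --> w.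
Proof.
move=> h; apply/cvgrPdist_le => e e0.
have n : \forall s \near FF, forall j, `|w 0 j - F s 0 j| <= e.
  apply: filter_forall => j.
  by have /cvgrPdist_le := h j; apply.
near=> s; apply: rV_norm_le => [|j]; first exact: ltW.
rewrite !mxE.
have : forall j, `|w 0 j - F s 0 j| <= e by near: s.
exact.
Unshelve. all: by end_near. Qed.

Section Continuity.
Context {R : realType} {n m : nat} (X : manifold R n).

(** A function on the cotangent bundle is continuous along a path as soon as its
    expression in one chart is continuous at the point. *)
Lemma cvg_cotangent (W : topologicalType)
    (F : X -> 'rV[R]_n -> 'rV[R]_m -> W) a b z (w : R -> 'rV[R]_m) t
    (i : chart_index X) :
  continuous_cotangent a b z -> {within `[a, b], continuous w} ->
  t \in `[a, b] -> dom i (z t).1 ->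
  {for (phi i (z t).1, covec_coord i (z t), w t),
    continuous (fun c => cotangent_local i F c.1.1 c.1.2 c.2)} ->
  F (z s).1 (z s).2 (w s) @[s --> within `[a, b] (nbhs t)]
    --> F (z t).1 (z t).2 (w t).
Proof.
move=> [/within_itvP cx cp] /within_itvP cw tab di cF.
have cq : phi i (z s).1 @[s --> within `[a, b] (nbhs t)] --> phi i (z t).1.
  by apply: cvg_chart; [exact: cx|exact: di].
have cqpw : (phi i (z s).1, covec_coord i (z s), w s)
    @[s --> within `[a, b] (nbhs t)] -->
    (phi i (z t).1, covec_coord i (z t), w t).
  apply: (cvg_pair (G := nbhs (phi i (z t).1, covec_coord i (z t)))
    (H := nbhs (w t))); last exact: cw.
  by apply: (cvg_pair (G := nbhs (phi i (z t).1))
    (H := nbhs (covec_coord i (z t)))); [exact: cq|exact: cp].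
have e : cotangent_local i F (phi i (z t).1) (covec_coord i (z t)) (w t)
    = F (z t).1 (z t).2 (w t) by rewrite cotangent_localK.
have := cvg_comp _ _ cqpw cF; rewrite /= e; apply: cvg_trans.
apply: near_eq_cvg.
have near_domain : \forall s \near within `[a, b] (nbhs t), dom i (z s).1.
  by apply: (cx t tab (dom i)); exact: near_dom.
by near=> s; rewrite /= cotangent_localK//; near: s.
Unshelve. all: by end_near. Qed.

Variables (f : X -> 'rV[R]_m -> 'rV[R]_n) (h : X -> 'rV[R]_m -> 'rV[R]_m).
Hypotheses (hf : Ck_field 2 f) (hh : Ck_fun 2 h).

Lemma sigma_output_continuous a b u x y : sigma f h a b u x y ->
  {within `[a, b], continuous y}.
Proof.
move=> [/within_itvP cu /within_itvP cx _ hy]; apply/within_itvP => t tab.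
have di := dom_chart_at (x t); set i := chart_at (x t) in di.
have Da : state_input_dom (m:=m) i (phi i (x t), u t) by exact: phi_dom.
have ch := (CkS (CkS (hh i)) : Ck 0 _ _) _ Da.
have cq : phi i (x s) @[s --> within `[a, b] (nbhs t)] --> phi i (x t).
  by apply: cvg_chart; [exact: cx|exact: di].
have cqu : (phi i (x s), u s) @[s --> within `[a, b] (nbhs t)]
    --> (phi i (x t), u t).
  by apply: (cvg_pair (G := nbhs (phi i (x t))) (H := nbhs (u t)));
    [exact: cq|exact: cu].
have := cvg_comp _ _ cqu ch; rewrite /= phiK// -hy//; apply: cvg_trans.
apply: near_eq_cvg.
have near_domain : \forall s \near within `[a, b] (nbhs t), dom i (x s).
  by apply: (cx t tab (dom i)); exact: near_dom.
have ni : \forall s \near within `[a, b] (nbhs t), s \in `[a, b].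
  by rewrite near_withinE; near=> s.
near=> s; have ds : dom i (x s) by near: s.
have is_ : s \in `[a, b] by near: s.
by rewrite /= phiK// hy.
Unshelve. all: by end_near. Qed.

Lemma sigma_plus_output_continuous a b u z y : sigma_plus f h a b u z y ->
  {within `[a, b], continuous y}.
Proof.
move=> [[cu cz _] hy]; apply/within_itvP => t tab.
have di := dom_chart_at (z t).1; set i := chart_at (z t).1 in di.
have cg : {for (phi i (z t).1, covec_coord i (z t), u t), continuous (fun c =>
    cotangent_local i (fun x p w => grad (Hplus f h x p) w) c.1.1 c.1.2 c.2)}.
  set a0 := (_, _, _).
  have Da : phase_dom (m:=m) i a0 by exact: phi_dom.
  apply: cvg_row => j.
  have [_ DH] := Hplus_local_Ck2 hf hh i.
  have cD : 'D_(0, delta_mx 0 j) (Hplus_local f h i) c @[c --> a0]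
      --> 'D_(0, delta_mx 0 j) (Hplus_local f h i) a0.
    exact: (differentiable_continuous ((DH (0, delta_mx 0 j)).1 a0 Da)).
  have gE c : 'D_(0, delta_mx 0 j) (Hplus_local f h i) c =
      (cotangent_local i (fun x p w => grad (Hplus f h x p) w) c.1.1 c.1.2 c.2) 0 j.
    by rewrite /cotangent_local mxE -(derive_partial2 (Hplus_local f h i) c).
  rewrite gE in cD; apply: cvg_trans cD; apply: near_eq_cvg.
  by near=> c; rewrite gE.
have := cvg_cotangent cz cu tab di cg; rewrite -hy//; apply: cvg_trans.
apply: near_eq_cvg; rewrite near_withinE; near=> s => is_.
by rewrite /= hy.
Unshelve. all: by end_near. Qed.

End Continuity.

Section Inverse.
Context {R : realType} {n m : nat} (X : manifold R n).
Variables (f : X -> 'rV[R]_m -> 'rV[R]_n) (h : X -> 'rV[R]_m -> 'rV[R]_m).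
Hypotheses (hf : Ck_field 2 f) (hh : Ck_fun 2 h).
Variable upsilon : X -> 'rV[R]_n -> 'rV[R]_m -> 'rV[R]_m.
Hypotheses (hups : Ck_cotangent 1 upsilon) (hsolve : solves_output_eq f h upsilon).
Local Notation phase := ('rV[R]_n * 'rV[R]_n * 'rV[R]_m)%type.

Definition upsilon_local (i : chart_index X) (a : phase) : 'rV[R]_m :=
  cotangent_local i upsilon a.1.1 a.1.2 a.2.

Definition Htimes_local (i : chart_index X) (a : phase) : R :=
  cotangent_local i (Htimes f h upsilon) a.1.1 a.1.2 a.2.

(** The Legendre envelope property for the two Hamiltonians; the critical
    point condition is the equation solved by [upsilon]. *)
Lemma derive_Htimes_local i (a d : phase) : phase_dom i a ->
  'D_d (Htimes_local i) a =
    'D_(d.1, 0) (Hplus_local f h i) (a.1, upsilon_local i a)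
    - dotp (upsilon_local i a) d.2.
Proof.
move=> Da.
apply: (@derive_legendre R _ m (Hplus_local f h i) (upsilon_local i) a d).
- exact: (proj1 (hups i) a Da).
- exact: (Hplus_local_differentiable hf hh).
- set x := psi i a.1.1; set p := covec_change i (chart_at x) x a.1.2.
  exact: (hsolve x p a.2).
Qed.

Lemma derive_Htimes_costate_state i (a : phase) d : phase_dom i a ->
  'D_d (fun b => Htimes_local i (b, a.2)) a.1 =
  'D_d (fun b => Hplus_local f h i (b, upsilon_local i a)) a.1.
Proof.
move=> Da; rewrite (derive_partial1 (Htimes_local i) a d).
rewrite (derive_Htimes_local (d, 0) Da) /= dotp0r subr0.
by rewrite -(derive_partial1 (Hplus_local f h i) (a.1, upsilon_local i a) d).
Qed.

Lemma sigma_times_output a b y z u t : sigma_times f h upsilon a b y z u ->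
  t \in `[a, b] -> u t = upsilon (z t).1 (z t).2 (y t).
Proof.
move=> [_ hu] tab; rewrite (hu t tab).
have di := dom_chart_at (z t).1; set i := chart_at (z t).1 in di.
pose c : phase := (phi i (z t).1, covec_coord i (z t), y t).
have Dc : phase_dom (m:=m) i c by exact: phi_dom.
have -> : Htimes f h upsilon (z t).1 (z t).2 = (fun w => Htimes_local i (c.1, w)).
  by apply/funext => w; rewrite /Htimes_local /= cotangent_localK.
have -> : upsilon (z t).1 (z t).2 (y t) = upsilon_local i c.
  by rewrite /upsilon_local /= cotangent_localK.
apply/rowP => j; rewrite !mxE.
have -> : 'D_(delta_mx 0 j) (fun w => Htimes_local i (c.1, w)) (y t) =
    - dotp (upsilon_local i c) (delta_mx 0 j).
  rewrite (derive_partial2 (Htimes_local i) c (delta_mx 0 j)).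
  rewrite (derive_Htimes_local (0, delta_mx 0 j) Dc).
  by rewrite (_ : (0, _).1 = 0)// derive0 sub0r.
rewrite opprK /dotp (bigD1 j)//= mxE !eqxx mulr1 big1 ?addr0// => k kj.
by rewrite mxE (negbTE kj) mulr0.
Qed.

(** The two Hamiltonians have the same derivatives in position and costate at
    corresponding points, and the derivative of [Htimes] in its input
    recovers minus the input of the original system. *)
Lemma sigma_times_sigma_plus a b y z u : sigma_times f h upsilon a b y z u ->
  sigma_plus f h a b u z y.
Proof.
move=> st; have uE := fun t => @sigma_times_output a b y z u t st.
have [[cy cz dz] _] := st.
split; last by move=> t tab; rewrite uE// hsolve.
split => //.
  apply/within_itvP => t tab; rewrite (uE t tab).
  have di := dom_chart_at (z t).1; set i := chart_at (z t).1 in di.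
  have Da : phase_dom (m:=m) i (phi i (z t).1, covec_coord i (z t), y t).
    exact: phi_dom.
  have := cvg_cotangent cz cy tab di ((CkS (hups i) : Ck 0 _ _) _ Da).
  apply: cvg_trans; apply: near_eq_cvg; rewrite near_withinE.
  by near=> s => sab; rewrite (uE s sab).
move=> t tab i di; have tab' : t \in `[a, b] by exact: subset_itv_oo_cc.
pose c : phase := (phi i (z t).1, covec_coord i (z t), y t).
have Dc : phase_dom (m:=m) i c by exact: phi_dom.
have uc : upsilon_local i c = u t by rewrite /upsilon_local /= cotangent_localK// uE.
have [dq dp] := dz t tab i di.
split.
  apply: (is_derive_eq dq); apply/rowP => k; rewrite !mxE.
  have e1 := derive_partial2 (fun b => Htimes_local i (b, y t)) c.1 (delta_mx 0 k).
  have e2 := derive_partial2 (fun b => Hplus_local f h i (b, u t)) c.1 (delta_mx 0 k).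
  have e3 := derive_Htimes_costate_state (0, delta_mx 0 k) Dc.
  rewrite uc in e3.
  exact: (etrans e1 (etrans e3 (esym e2))).
apply: (is_derive_eq dp); congr (- _); apply/rowP => k; rewrite !mxE.
have e1 := derive_partial1 (fun b => Htimes_local i (b, y t)) c.1 (delta_mx 0 k).
have e2 := derive_partial1 (fun b => Hplus_local f h i (b, u t)) c.1 (delta_mx 0 k).
have e3 := derive_Htimes_costate_state (delta_mx 0 k, 0) Dc.
rewrite uc in e3.
exact: (etrans e1 (etrans e3 (esym e2))).
Unshelve. all: by end_near. Qed.

End Inverse.

(** * Optimality *)

Lemma is_derive_of_quadratic (R : realType) (g : R -> R) (s0 k C : R) :
  (\forall s \near 0, `|g (s0 + s) - g s0 - s * k| <= C * s ^+ 2) ->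
  is_derive s0 1 g k.
Proof.
move=> hC.
suff c : h^-1 *: ((g \o shift s0) (h *: (1 : R)) - g s0) @[h --> 0^'] --> k.
  by split; [apply/cvg_ex; exists k|exact: cvg_lim c].
apply/cvgrPdist_lt => e e0.
have hC' : \forall s \near 0^', `|g (s0 + s) - g s0 - s * k| <= C * s ^+ 2.
  exact: cvg_within hC.
have hs : \forall s \near (0 : R)^', `|C| * `|s| < e.
  move: (near0_mul_lt `|C| e0).
  exact: (@cvg_within _ _ _ _ (fun s => is_true (`|C| * `|s| < e))).
near=> s.
have s_neq0 : s != 0 by near: s; exact: nbhs_dnbhs_neq.
have b1 : `|g (s0 + s) - g s0 - s * k| <= C * s ^+ 2 by near: s.
have b2 : `|C| * `|s| < e by near: s.
rewrite /= [s *: 1]mulr1 (addrC s).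
have -> : k - s^-1 *: (g (s0 + s) - g s0) =
    - (s^-1 * (g (s0 + s) - g s0 - s * k)).
  rewrite [s^-1 *: _]/(s^-1 * _) [in RHS]mulrBr mulrA mulVf// mul1r.
  by rewrite opprB.
rewrite normrN normrM normfV ltr_pdivrMl ?normr_gt0//.
apply: (le_lt_trans b1); apply: le_lt_trans (_ : `|s| * (`|C| * `|s|) < _).
  rewrite [leRHS]mulrCA -expr2 real_normK ?num_real// ler_wpM2r ?sqr_ge0//.
  exact: ler_norm.
by rewrite ltr_pM2l ?normr_gt0.
Unshelve. all: by end_near. Qed.

Section Optimality.
Context {R : realType} {n m : nat} (X : manifold R n).
Variables (f : X -> 'rV[R]_m -> 'rV[R]_n) (h : X -> 'rV[R]_m -> 'rV[R]_m).
Hypotheses (hf : Ck_field 2 f) (hh : Ck_fun 2 h).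
Variables (T : R) (yS : R -> 'rV[R]_m).
Hypothesis T_gt0 : 0 < T.
Hypothesis cyS : {within `[0, T], continuous yS}.

Lemma within_dotp_continuous a b (v w : R -> 'rV[R]_m) :
  {within `[a, b], continuous v} -> {within `[a, b], continuous w} ->
  {within `[a, b], continuous (fun t => dotp (v t) (w t))}.
Proof.
move=> /within_itvP cv /within_itvP cw; apply/within_itvP => t tab.
by apply: cvg_dotp; [exact: cv|exact: cw].
Qed.

Lemma withinB_continuous a b (v w : R -> 'rV[R]_m) :
  {within `[a, b], continuous v} -> {within `[a, b], continuous w} ->
  {within `[a, b], continuous (fun t => v t - w t)}.
Proof.
move=> /within_itvP cv /within_itvP cw; apply/within_itvP => t tab.
by apply: cvgB; [exact: cv|exact: cw].
Qed.

Definition power (u y : R -> 'rV[R]_m) : R :=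
  \int[lebesgue_measure]_(t in `[0, T]) dotp (y t - yS t) (u t).

(** The derivative of the supplied power with respect to the input, in the
    direction [v], is the integral of [dotp (v t) (yp t - yS t)]: the output of
    the Hamiltonian system is the variational gradient. The trajectories
    [xs s] are arbitrary solutions, including [xs 0]. *)
Lemma power_variation u z yp (v : R -> 'rV[R]_m)
    (xs : R -> R -> X) (ys : R -> R -> 'rV[R]_m) :
  sigma_plus f h 0 T u z yp -> (z T).2 = 0 ->
  {within `[0, T], continuous v} ->
  (forall s : R, sigma f h 0 T (fun t => u t + s *: v t) (xs s) (ys s)) ->
  (forall s, xs s 0 = (z 0).1) ->
  exists C : R, \forall s \near 0,
    `|power (fun t => u t + s *: v t) (ys s)
      - power u (fun t => h (z t).1 (u t))
      - s * \int[lebesgue_measure]_(t in `[0, T]) dotp (v t) (yp t - yS t)|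
    <= C * s ^+ 2.
Proof.
move=> hz zT cv hxs xs0; have sz := sigma_plus_sigma hz.
pose w s t := dotp (ys s t - yS t) (u t + s *: v t).
pose w0 t := dotp (h (z t).1 (u t) - yS t) (u t).
pose k t := dotp (v t) (yp t - yS t).
have cw s : {within `[0, T], continuous (w s)}.
  apply: within_dotp_continuous; last by case: (hxs s).
  by apply: withinB_continuous => //; exact: sigma_output_continuous (hxs s).
have cw0 : {within `[0, T], continuous w0}.
  apply: within_dotp_continuous; last by case: sz.
  by apply: withinB_continuous => //; exact: sigma_output_continuous sz.
have ck : {within `[0, T], continuous k}.
  apply: within_dotp_continuous => //; apply: withinB_continuous => //.
  exact: sigma_plus_output_continuous hz.
have [W00 cW0 dW0] := primitive_of_continuous T_gt0 cw0.
have [K0 cK dK] := primitive_of_continuous T_gt0 ck.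
pose prim (g : R -> R) t := \int[lebesgue_measure]_(s in `[0, t]) g s.
pose r s t := prim (w s) t - prim w0 t - s * prim k t.
apply: (@family_quadratic_bound R n m X f h hf hh T u z yp v T_gt0 hz cv
  xs ys hxs xs0 r) => //.
- move=> s; have [Ws0 _ _] := primitive_of_continuous T_gt0 (cw s).
  by rewrite /r /prim Ws0 W00 K0 mulr0 !subr0.
- move=> s; have [_ /within_itvP cWs _] := primitive_of_continuous T_gt0 (cw s).
  move/within_itvP : cW0 => cW0; move/within_itvP : cK => cK.
  apply/within_itvP => t t0T; apply: cvgB.
    by apply: cvgB; [exact: cWs|exact: cW0].
  by apply: cvgM; [exact: cvg_cst|exact: cK].
move=> s t t0T; have [_ _ dWs] := primitive_of_continuous T_gt0 (cw s).
have dr := is_deriveB (is_deriveB (dWs t t0T) (dW0 t t0T))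
  (is_deriveZ s (dK t t0T)).
apply: (is_derive_eq dr).
have [_ _ _ ysE] := hxs s; rewrite /w /w0 /k ysE; last exact: subset_itv_oo_cc.
change (dotp (h (xs s t) (u t + s *: v t) - yS t) (u t + s *: v t)
  - dotp (h (z t).1 (u t) - yS t) (u t) - s * dotp (v t) (yp t - yS t)
  = dotp (u t + s *: v t) (h (xs s t) (u t + s *: v t))
  - dotp (u t) (h (z t).1 (u t)) - s * dotp (v t) (yp t)).
rewrite !dotpBl !dotpBr (dotpC (v t) (yS t)) !dotpDr !dotpDl !dotpZr !dotpZl.
rewrite !(dotpC (h _ _)).
have regroup (a b c d e g : R) : a + s * b - (c + s * d) - (e - c) - s * (g - d)
    = a + s * b - e - s * g by ring.
exact: regroup.
Qed.

(** Applied to a constant family with [v = 0], the quadratic bound at [s = 0]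
    says that the two costs coincide; uniqueness of trajectories need not be
    established separately. *)
Lemma power_unique u z yp x y :
  sigma_plus f h 0 T u z yp -> (z T).2 = 0 ->
  sigma f h 0 T u x y -> x 0 = (z 0).1 ->
  power u y = power u (fun t => h (z t).1 (u t)).
Proof.
move=> hz zT sx x0.
have uE (s : R) : (fun t => u t + s *: (0 : 'rV[R]_m)) = u.
  by apply/funext => t; rewrite scaler0 addr0.
have c0 : {within `[0, T], continuous (fun=> 0 : 'rV[R]_m)}.
  by move=> t; exact: cvg_cst.
have hx (s : R) : sigma f h 0 T (fun t => u t + s *: (0 : 'rV[R]_m)) x y by rewrite uE.
have [C hC] := power_variation hz zT c0 hx (fun=> x0).
have := nbhs_singleton hC.
rewrite uE mul0r subr0 expr0n /= mulr0 normr_le0 subr_eq0 => /eqP.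
exact.
Qed.

Variables (x0 : X) (S : X * 'rV[R]_n -> X * 'rV[R]_n -> R).
Hypothesis hS : storage_function (sigma_plus f h) S.
Hypothesis hS0 : storage_zero_at_bvp f h x0 T S.

(** Integrated along both copies, the passivity inequality bounds the integral
    from below by the increase of the storage function, which starts from
    [0] and stays nonnegative. *)
Lemma passivity_integral_ge0 u1 z1 y1 u2 z2 y2 (v : R -> 'rV[R]_m) s :
  sigma_plus f h 0 T u1 z1 y1 -> mixed_bc x0 T z1 ->
  sigma_plus f h 0 T u2 z2 y2 -> mixed_bc x0 T z2 ->
  {within `[0, T], continuous v} -> (forall t, u1 t - u2 t = s *: v t) ->
  0 <= s * \int[lebesgue_measure]_(t in `[0, T]) dotp (v t) (y1 t - y2 t).
Proof.
move=> h1 bc1 h2 bc2 cv uE; have [S_ge0 /(_ 0 T)] := hS.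
move=> /(_ _ _ _ _ _ _ h1 h2)[cS dS].
pose k t := dotp (v t) (y1 t - y2 t).
have ck : {within `[0, T], continuous k}.
  apply: within_dotp_continuous => //; apply: withinB_continuous.
    exact: sigma_plus_output_continuous h1.
  exact: sigma_plus_output_continuous h2.
pose K t := \int[lebesgue_measure]_(s in `[0, t]) k s.
have [K0 cK dK] : [/\ K 0 = 0, {within `[0, T], continuous K}
    & forall t, t \in `]0, T[ -> is_derive t 1 K (k t)].
  exact: primitive_of_continuous.
have S0 : S (z1 0) (z2 0) = 0.
  have := hS0 h1 bc1 h2 bc2.
  by rewrite -{1}bc1.1 -bc2.1 -!surjective_pairing.
pose g t := s * K t - S (z1 t) (z2 t).
have dg t : t \in `]0, T[ -> is_derive t 1 g
    (s *: k t - 'D_1 (fun t => S (z1 t) (z2 t)) t).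
  move=> t0T; have [dSt _] := dS t t0T.
  exact: (is_deriveB (is_deriveZ s (dK t t0T)) (derivableP dSt)).
have : g 0 <= g T.
  apply: (@ger0_derive1_ndecr R g 0 T) => //; last exact: ltW.
  - by move=> t /dg[].
  - move=> t t0T; rewrite derive1E; have [_ ->] := dg t t0T.
    have [_ le] := dS t t0T; rewrite subr_ge0 (le_trans le)//.
    by rewrite uE dotpZr dotpC.
  - move/within_itvP : cS => cS; move/within_itvP : cK => cK.
    apply/within_itvP => t t0T; apply: cvgB; last exact: cS.
    by apply: cvgM; [exact: cvg_cst|exact: cK].
rewrite /g K0 mulr0 S0 subrr subr_ge0; apply: le_trans; exact: S_ge0.
Qed.

Hypothesis hwp : well_posed f h x0 T.

(** On the segment [uh + s v] the derivative of the cost is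
    [k s], the integral of [dotp (v t) (yps s t - yS t)]. As [yS] is the output
    for the input [uh], passivity of the pair [(uh + s v, uh)] gives
    [0 <= s * k s], so the cost is nondecreasing on [[0, 1]]. *)
Lemma power_minimal uh zh u x y :
  sigma_plus f h 0 T uh zh yS -> mixed_bc x0 T zh ->
  sigma f h 0 T u x y -> x 0 = x0 ->
  power uh (fun t => h (zh t).1 (uh t)) <= power u y.
Proof.
move=> hzh bch sx x0E.
have cuh : {within `[0, T], continuous uh} by case: hzh => -[].
have cu : {within `[0, T], continuous u} by case: sx.
pose v t : 'rV[R]_m := u t - uh t; pose us (s : R) t : 'rV[R]_m := uh t + s *: v t.
have cv : {within `[0, T], continuous v} by exact: withinB_continuous.
have cus s : {within `[0, T], continuous (us s)}.
  move/within_itvP : cuh => cuh'; move/within_itvP : cv => cv'.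
  apply/within_itvP => t t0T; apply: cvgD; first exact: cuh'.
  by apply: cvgZr; exact: cv'.
have /choice[zs /choice[yps hzs]] : forall s, exists z y,
    sigma_plus f h 0 T (us s) z y /\ mixed_bc x0 T z by move=> s; exact: hwp.
pose g s := power (us s) (fun t => h (zs s t).1 (us s t)).
pose k s := \int[lebesgue_measure]_(t in `[0, T]) dotp (v t) (yps s t - yS t).
have dg (s : R) : is_derive s 1 g (k s).
  have [hz [z0 zT]] := hzs s.
  have usD (s' : R) : (fun t => us s t + s' *: v t) = us (s + s').
    by apply/funext => t; rewrite /us scalerDl addrA.
  have hfam (s' : R) : sigma f h 0 T (fun t => us s t + s' *: v t)
      (fun t => (zs (s + s') t).1)
      (fun t => h (zs (s + s') t).1 (us (s + s') t)).
    by rewrite usD; apply: sigma_plus_sigma; exact: (hzs _).1.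
  have hfam0 s' : (zs (s + s') 0).1 = (zs s 0).1.
    by rewrite z0; have [_ [->]] := hzs (s + s').
  have [C hC] := power_variation hz zT cv hfam hfam0.
  apply: (@is_derive_of_quadratic _ _ _ _ C).
  by apply: filterS hC => s'; rewrite usD.
have k_ge0 (s : R) : 0 < s -> 0 <= k s.
  move=> s0; have [hz bc] := hzs s.
  rewrite -(pmulr_rge0 _ s0).
  apply: (passivity_integral_ge0 hz bc hzh bch cv) => t.
  by rewrite /us addrAC subrr add0r.
have g01 : g 0 <= g 1.
  apply: (@ger0_derive1_ndecr R g 0 1) => //.
  - move=> s; rewrite in_itv /= => /andP[s0 _]; rewrite derive1E.
    by have [_ ->] := dg s; exact: k_ge0.
  by apply: derivable_within_continuous => s _; have [ds _] := dg s; exact: ds.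
have us0 : us 0 = uh by apply/funext => t; rewrite /us scale0r addr0.
have us1 : us 1 = u by apply/funext => t; rewrite /us scale1r addrC subrK.
have g0E : power uh (fun t => h (zh t).1 (uh t)) = g 0.
  have [hz [z0 zT]] := hzs 0; rewrite /g; rewrite us0 in hz *.
  by apply: power_unique hz zT (sigma_plus_sigma hzh) _; rewrite z0 bch.1.
have g1E : power u y = g 1.
  have [hz [z0 zT]] := hzs 1; rewrite /g; rewrite us1 in hz *.
  by apply: power_unique hz zT sx _; rewrite z0.
by rewrite g0E g1E.
Qed.

End Optimality.

Unset Implicit Arguments.

Theorem theorem2p3 (R : realType) (n m : nat) (X : manifold R n)
    (f : X -> 'rV[R]_m -> 'rV[R]_n) (h : X -> 'rV[R]_m -> 'rV[R]_m)
    (hf : Ck_field 2 f) (hh : Ck_fun 2 h)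
    (x0 : X) (T : R) (T_gt0 : 0 < T)
    (hwp : well_posed f h x0 T)
    (hrank : forall x p u, \rank (hessian (Hplus f h x p) u) = m)
    (upsilon : X -> 'rV[R]_n -> 'rV[R]_m -> 'rV[R]_m)
    (hups : Ck_cotangent 1 upsilon)
    (hsolve : solves_output_eq f h upsilon)
    (S : X * 'rV[R]_n -> X * 'rV[R]_n -> R)
    (hS : storage_function (sigma_plus f h) S)
    (hS0 : storage_zero_at_bvp f h x0 T S)
    (yS : R -> 'rV[R]_m) (hyS : {within `[0, T], continuous yS})
    (uh : R -> 'rV[R]_m) (huh : inverse_output f h upsilon x0 T yS uh) :
  (exists ch, power_value f h x0 T yS uh ch) /\
  (forall u ch c, power_value f h x0 T yS uh ch ->
     power_value f h x0 T yS u c -> ch <= c).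
Proof.
have [zh [times_zh bc_zh _]] := huh.
have hzh := sigma_times_sigma_plus hf hh hups hsolve times_zh.
split.
  exists (power T yS uh (fun t => h (zh t).1 (uh t))).
  exists (fun t => (zh t).1), (fun t => h (zh t).1 (uh t)).
  by split => //; [exact: sigma_plus_sigma hzh|exact: bc_zh.1].
move=> u ch c [xh [yh [sxh xh0 ->]]] [x [y [sx x0E ->]]].
rewrite -![Rintegral _ _ _]/(power T yS _ _).
rewrite (power_unique hf hh T_gt0 hyS hzh bc_zh.2 sxh); last first.
  by rewrite xh0 bc_zh.1.
exact: (power_minimal hf hh T_gt0 hyS hS hS0 hwp hzh bc_zh sx x0E).
Qed.
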